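(* For each solution $r$ of the classical Yang-Baxter equation on the 4-dimensional oscillator group $O$, the Lie group $O^*(r)$ is endowed with a flat left invariant Lorentz metric, a symplectic form, and a flat affine left invariant connection.
   Context: The Heisenberg group is $\mathsf{H}_3=\mathbb{R}\times\mathbb{C}$ with product $(s,w)(s',w')=(s+s'+\frac12\mathrm{Im}(\overline{w}w'),w+w')$. The oscillator group $O$ of dimension 4 is the semidirect product of $\mathsf{H}_3$ by $(\mathbb{R},+)$ via $\rho(t)(s,z)=(s,e^{it}z)$. Its Lie algebra $\mathfrak{o}$ has basis $(e_0,e_1,e_2,d)$ with nonzero brackets (up to antisymmetry) $[e_1,e_2]=e_0$, $[d,e_1]=e_2$, $[d,e_2]=-e_1$. A solution of the classical Yang-Baxter equation (CYBE) on a Lie group $G$ with Lie algebra $\mathfrak{g}$ is a bivector $r\in\wedge^2\mathfrak{g}$ with $[r,r]=0$ (Schouten bracket), equivalently $\alpha([r_\sharp(\beta),r_\sharp(\gamma)])+\beta([r_\sharp(\gamma),r_\sharp(\alpha)])+\gamma([r_\sharp(\alpha),r_\sharp(\beta)])=0$ for all $\alpha,\beta,\gamma\in\mathfrak{g}^*$, where $r_\sharp:\mathfrak{g}^*\to\mathfrak{g}$ is given by $\beta(r_\sharp(\alpha))=r(\alpha,\beta)$. Such an $r$ defines the Lie bracket $[\alpha,\beta]_r=\mathrm{ad}^*_{r_\sharp(\beta)}\alpha-\mathrm{ad}^*_{r_\sharp(\alpha)}\beta$ on $\mathfrak{g}^*$; the resulting Lie algebra is $\mathfrak{g}^*(r)$,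 and $G^*(r)$ denotes a Lie group with Lie algebra $\mathfrak{g}^*(r)$. For $G=O$ the solutions considered are $r=\alpha_1e_0\wedge e_1+\alpha_2e_0\wedge e_2+\alpha_3e_0\wedge d$ with $\alpha_1,\alpha_2,\alpha_3\in\mathbb{R}$, and the dual Lie algebra $\mathfrak{o}^*(r)$, with dual basis $(e_0^*,e_1^*,e_2^*,d^* )$, has nonzero brackets (up to antisymmetry) $[e_0^*,e_1^*]=-\alpha_2d^*+\alpha_3e_2^*$ and $[e_0^*,e_2^*]=\alpha_1d^*-\alpha_3e_1^*$. The group $O^*(r)$ is a Lie group with Lie algebra $\mathfrak{o}^*(r)$. A flat affine connection is a linear connection with vanishing torsion and curvature; it is left invariant if left multiplications are affine transformations. A Lorentz metric is a pseudo-Riemannian metric of Lorentzian signature; it is flat if its Levi-Civita connection has zero curvature. *)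

(* Defs.v *)
From HB Require Import structures.
From mathcomp Require Import all_boot all_order all_algebra.
From mathcomp Require Import all_classical all_reals all_analysis.

Set Implicit Arguments.
Unset Strict Implicit.
Unset Printing Implicit Defensive.

Import Order.TTheory GRing.Theory Num.Theory.
Import numFieldNormedType.Exports.

Local Open Scope classical_set_scope.
Local Open Scope ring_scope.

(* Intended for open [A].  Since [f] is Frechet differentiable on [A],
   ['D_v f x] is the value at [v] of the differential of [f] at [x]; in finite
   dimension, differentiating in every constant direction is the same as
   differentiating the map [x |-> 'd f x]. *)
Fixpoint times_differentiable (R : realType) (V W : normedModType R) (k : nat)
    (A : set V) (f : V -> W) : Prop :=
  if k is k'.+1 then
    (forall x, A x -> differentiable f x) /\
    (forall v, times_differentiable k' A (fun x => 'D_v f x))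
  else True.

Definition smooth_on (R : realType) (V W : normedModType R)
    (A : set V) (f : V -> W) : Prop :=
  forall k, times_differentiable k A f.

(* The total functions [chart_fun] and [chart_inv] are only meaningful on
   [chart_dom] and [chart_cod] respectively. *)
Record chart (R : realType) (n : nat) (M : Type) := Chart {
  chart_dom : set M;
  chart_fun :> M -> 'rV[R]_n;
  chart_inv : 'rV[R]_n -> M }.

Definition chart_cod (R : realType) (n : nat) (M : Type) (c : chart R n M) :
    set 'rV[R]_n :=
  c @` chart_dom c.

Definition is_chart (R : realType) (n : nat) (M : topologicalType)
    (c : chart R n M) : Prop :=
  [/\ open (chart_dom c), open (chart_cod c),
      forall p, chart_dom c p -> chart_inv c (c p) = p,
      forall p, chart_dom c p -> {for p, continuous c} &
      forall x, chart_cod c x -> {for x, continuous (chart_inv c)}].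

Definition smooth_transition (R : realType) (n : nat) (M : Type)
    (c c' : chart R n M) : Prop :=
  smooth_on (c @` (chart_dom c `&` chart_dom c')) (c' \o chart_inv c).

(* A preferred chart [chart_at p] around every point is part of the data: it
   is used to represent the tangent space at [p] by ['rV[R]_n], see below. *)
HB.mixin Record isManifold (R : realType) (n : nat) M of Topological M := {
  atlas : set (chart R n M);
  chart_at : M -> chart R n M;
  atlas_chart : forall c, atlas c -> is_chart c;
  atlas_smooth : forall c c', atlas c -> atlas c' -> smooth_transition c c';
  chart_at_atlas : forall p, atlas (chart_at p);
  chart_at_dom : forall p, chart_dom (chart_at p) p;
  manifold_hausdorff : hausdorff_space M;
  manifold_second_countable : @second_countable M }.

#[short(type="manifoldType")]
HB.structure Definition Manifold (R : realType) (n : nat) :=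
  {M of Topological M & isManifold R n M}.

HB.mixin Record isLieGroup (R : realType) (n : nat) G
    of Manifold R n G & Group G := {
  mul_continuous : continuous (fun pq : G * G => (pq.1 * pq.2)%g);
  mul_smooth : forall a b c : chart R n G, atlas a -> atlas b -> atlas c ->
    smooth_on
      [set xy : 'rV[R]_n * 'rV[R]_n | [/\ chart_cod a xy.1, chart_cod b xy.2
         & chart_dom c (chart_inv a xy.1 * chart_inv b xy.2)%g]]
      (fun xy => c (chart_inv a xy.1 * chart_inv b xy.2)%g);
  inv_continuous : continuous (fun p : G => (p^-1)%g);
  inv_smooth : forall a c : chart R n G, atlas a -> atlas c ->
    smooth_on
      [set x | chart_cod a x /\ chart_dom c ((chart_inv a x)^-1)%g]
      (fun x => c ((chart_inv a x)^-1)%g) }.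

#[short(type="lieGroupType")]
HB.structure Definition LieGroup (R : realType) (n : nat) :=
  {G of Manifold R n G & Group G & isLieGroup R n G}.

(* A row vector [v : 'rV[R]_n] stands for the tangent vector at [p] whose
   coordinates in the chart [chart_at p] are [v]. *)
Definition tangent_map (R : realType) (m n : nat) (M : manifoldType R m)
    (N : manifoldType R n) (f : M -> N) (p : M) (v : 'rV[R]_m) : 'rV[R]_n :=
  'D_v (chart_at (f p) \o f \o chart_inv (chart_at p)) (chart_at p p).

Definition smooth_fun (R : realType) (n : nat) (M : manifoldType R n)
    (f : M -> R) : Prop :=
  forall c : chart R n M, atlas c -> smooth_on (chart_cod c) (f \o chart_inv c).

Definition vfield (R : realType) (n : nat) (M : manifoldType R n) : Type :=
  M -> 'rV[R]_n.

(* Change of coordinates from [chart_at p] to [c], as a function of [c p]. *)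
Definition vf_coord (R : realType) (n : nat) (M : manifoldType R n)
    (c : chart R n M) (X : vfield M) (x : 'rV[R]_n) : 'rV[R]_n :=
  let p := chart_inv c x in
  'D_(X p) (c \o chart_inv (chart_at p)) (chart_at p p).

Definition smooth_vf (R : realType) (n : nat) (M : manifoldType R n)
    (X : vfield M) : Prop :=
  forall c : chart R n M, atlas c -> smooth_on (chart_cod c) (vf_coord c X).

Definition vf_add (R : realType) (n : nat) (M : manifoldType R n)
    (X Y : vfield M) : vfield M :=
  fun p => X p + Y p.

Definition vf_sub (R : realType) (n : nat) (M : manifoldType R n)
    (X Y : vfield M) : vfield M :=
  fun p => X p - Y p.

Definition vf_scale (R : realType) (n : nat) (M : manifoldType R n)
    (f : M -> R) (X : vfield M) : vfield M :=
  fun p => f p *: X p.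

Definition vf_deriv (R : realType) (n : nat) (M : manifoldType R n)
    (X : vfield M) (f : M -> R) : M -> R :=
  fun p => 'D_(X p) (f \o chart_inv (chart_at p)) (chart_at p p).

(* In coordinates [X, Y]^k = X^i d_i Y^k - Y^i d_i X^k, so that
   [X, Y] f = X (Y f) - Y (X f). *)
Definition vf_bracket (R : realType) (n : nat) (M : manifoldType R n)
    (X Y : vfield M) : vfield M :=
  fun p => let c := chart_at p in
    'D_(X p) (vf_coord c Y) (c p) - 'D_(Y p) (vf_coord c X) (c p).

(* [b p] is the Gram matrix of the form at [p] in the chart [chart_at p]. *)
Definition form_field (R : realType) (n : nat) (M : manifoldType R n) : Type :=
  M -> 'M[R]_n.

Definition form_eval (R : realType) (n : nat) (M : manifoldType R n)
    (b : form_field M) (X Y : vfield M) : M -> R :=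
  fun p => (X p *m b p *m (Y p)^T) 0 0.

Definition smooth_form (R : realType) (n : nat) (M : manifoldType R n)
    (b : form_field M) : Prop :=
  forall X Y : vfield M, smooth_vf X -> smooth_vf Y ->
    smooth_fun (form_eval b X Y).

(* Signature (-, +, ..., +): the rows of [P] form a basis of the tangent space
   which is orthonormal for [g p], the first vector being timelike. *)
Definition lorentz_metric (R : realType) (n : nat) (M : manifoldType R n)
    (g : form_field M) : Prop :=
  smooth_form g /\
  forall p, (g p)^T = g p /\
    exists P : 'M[R]_n, P \in unitmx /\
      P *m g p *m P^T =
        diag_mx (\row_(i < n) (if (i : nat) == 0%N then - 1 else 1)).

Definition closed_2form (R : realType) (n : nat) (M : manifoldType R n)
    (w : form_field M) : Prop :=
  forall X Y Z : vfield M, smooth_vf X -> smooth_vf Y -> smooth_vf Z ->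
  forall p,
    vf_deriv X (form_eval w Y Z) p - vf_deriv Y (form_eval w X Z) p
    + vf_deriv Z (form_eval w X Y) p
    - form_eval w (vf_bracket X Y) Z p + form_eval w (vf_bracket X Z) Y p
    - form_eval w (vf_bracket Y Z) X p = 0.

Definition symplectic_form (R : realType) (n : nat) (M : manifoldType R n)
    (w : form_field M) : Prop :=
  [/\ smooth_form w,
      forall p, (w p)^T = - w p,
      forall p, w p \in unitmx &
      closed_2form w].

(* [nabla X Y] is the covariant derivative of [Y] along [X]; its values are
   only meaningful when [X] and [Y] are smooth. *)
Definition connection_op (R : realType) (n : nat) (M : manifoldType R n) : Type :=
  vfield M -> vfield M -> vfield M.

Definition affine_connection (R : realType) (n : nat) (M : manifoldType R n)
    (nabla : connection_op M) : Prop :=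
  [/\ forall X Y : vfield M, smooth_vf X -> smooth_vf Y ->
        smooth_vf (nabla X Y),
      forall X X' Y : vfield M, smooth_vf X -> smooth_vf X' -> smooth_vf Y ->
        nabla (vf_add X X') Y = vf_add (nabla X Y) (nabla X' Y),
      forall (f : M -> R) (X Y : vfield M),
        smooth_fun f -> smooth_vf X -> smooth_vf Y ->
        nabla (vf_scale f X) Y = vf_scale f (nabla X Y),
      forall X Y Y' : vfield M, smooth_vf X -> smooth_vf Y -> smooth_vf Y' ->
        nabla X (vf_add Y Y') = vf_add (nabla X Y) (nabla X Y') &
      forall (f : M -> R) (X Y : vfield M),
        smooth_fun f -> smooth_vf X -> smooth_vf Y ->
        nabla X (vf_scale f Y) =
        vf_add (vf_scale (vf_deriv X f) Y) (vf_scale f (nabla X Y))].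

Definition torsion (R : realType) (n : nat) (M : manifoldType R n)
    (nabla : connection_op M) (X Y : vfield M) : vfield M :=
  vf_sub (vf_sub (nabla X Y) (nabla Y X)) (vf_bracket X Y).

Definition curvature (R : realType) (n : nat) (M : manifoldType R n)
    (nabla : connection_op M) (X Y Z : vfield M) : vfield M :=
  vf_sub (vf_sub (nabla X (nabla Y Z)) (nabla Y (nabla X Z)))
         (nabla (vf_bracket X Y) Z).

Definition torsion_free (R : realType) (n : nat) (M : manifoldType R n)
    (nabla : connection_op M) : Prop :=
  forall X Y : vfield M, smooth_vf X -> smooth_vf Y ->
  forall p, torsion nabla X Y p = 0.

Definition curvature_free (R : realType) (n : nat) (M : manifoldType R n)
    (nabla : connection_op M) : Prop :=
  forall X Y Z : vfield M, smooth_vf X -> smooth_vf Y -> smooth_vf Z ->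
  forall p, curvature nabla X Y Z p = 0.

Definition flat_affine_connection (R : realType) (n : nat)
    (M : manifoldType R n) (nabla : connection_op M) : Prop :=
  [/\ affine_connection nabla, torsion_free nabla & curvature_free nabla].

Definition levi_civita (R : realType) (n : nat) (M : manifoldType R n)
    (g : form_field M) (nabla : connection_op M) : Prop :=
  [/\ affine_connection nabla, torsion_free nabla &
      forall X Y Z : vfield M, smooth_vf X -> smooth_vf Y -> smooth_vf Z ->
      forall p, vf_deriv X (form_eval g Y Z) p =
        form_eval g (nabla X Y) Z p + form_eval g Y (nabla X Z) p].

(* The Levi-Civita connection is unique on smooth vector fields. *)
Definition flat_metric (R : realType) (n : nat) (M : manifoldType R n)
    (g : form_field M) : Prop :=
  exists2 nabla : connection_op M, levi_civita g nabla & curvature_free nabla.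

Definition ltrans (R : realType) (n : nat) (G : lieGroupType R n)
    (a : G) : G -> G :=
  fun q => (a * q)%g.

Definition ltrans_vf (R : realType) (n : nat) (G : lieGroupType R n)
    (a : G) (X : vfield G) : vfield G :=
  fun p => let q := (a^-1 * p)%g in tangent_map (ltrans a) q (X q).

Definition left_invariant_vf (R : realType) (n : nat) (G : lieGroupType R n)
    (X : vfield G) : Prop :=
  smooth_vf X /\ forall a p, X (a * p)%g = tangent_map (ltrans a) p (X p).

Definition left_invariant_form (R : realType) (n : nat) (G : lieGroupType R n)
    (b : form_field G) : Prop :=
  forall (a p : G) (u v : 'rV[R]_n),
    (tangent_map (ltrans a) p u *m b (a * p)%g
       *m (tangent_map (ltrans a) p v)^T) 0 0
    = (u *m b p *m v^T) 0 0.

(* Left translations are affine transformations of [nabla]. *)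
Definition left_invariant_connection (R : realType) (n : nat)
    (G : lieGroupType R n) (nabla : connection_op G) : Prop :=
  forall (a : G) (X Y : vfield G), smooth_vf X -> smooth_vf Y ->
    ltrans_vf a (nabla X Y) = nabla (ltrans_vf a X) (ltrans_vf a Y).

(* The Lie algebra of [G], that is the space of left invariant vector fields
   with the bracket of vector fields, is isomorphic to the space ['cV[R]_n]
   with the bracket [br]. *)
Definition has_lie_algebra (R : realType) (n : nat) (G : lieGroupType R n)
    (br : 'cV[R]_n -> 'cV[R]_n -> 'cV[R]_n) : Prop :=
  exists Phi : 'cV[R]_n -> vfield G,
    [/\ forall (k : R) (a b : 'cV[R]_n) p,
          Phi (k *: a + b) p = k *: Phi a p + Phi b p,
        injective Phi,
        range Phi = [set X | left_invariant_vf X] &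
        forall a b, Phi (br a b) = vf_bracket (Phi a) (Phi b)].

(* A Lie algebra is given by a bracket [br] on ['rV[R]_n]; its dual space is
   represented by column vectors, holding the coordinates in the dual basis. *)
Definition pairing (R : realType) (n : nat) (a : 'cV[R]_n) (x : 'rV[R]_n) : R :=
  (x *m a) 0 0.

(* A bivector [r] is the antisymmetric matrix of the bilinear form
   (a, b) |-> r(a, b) on the dual, so that e_i /\ e_j has entry 1 at (i, j) and
   -1 at (j, i).  This is the vector [r_sharp r a] with
   pairing b (r_sharp r a) = r(a, b). *)
Definition r_sharp (R : realType) (n : nat) (r : 'M[R]_n) (a : 'cV[R]_n) :
    'rV[R]_n :=
  a^T *m r.

Definition cybe_solution (R : realType) (n : nat)
    (br : 'rV[R]_n -> 'rV[R]_n -> 'rV[R]_n) (r : 'M[R]_n) : Prop :=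
  r^T = - r /\
  forall a b c : 'cV[R]_n,
    pairing a (br (r_sharp r b) (r_sharp r c))
    + pairing b (br (r_sharp r c) (r_sharp r a))
    + pairing c (br (r_sharp r a) (r_sharp r b)) = 0.

(* (ad^*_x a)(y) = a([x, y]), without a minus sign: this is the convention for
   which the brackets of the dual of the oscillator algebra are
   [e0*, e1*] = - alpha2 d* + alpha3 e2* and
   [e0*, e2*] = alpha1 d* - alpha3 e1*. *)
Definition coad (R : realType) (n : nat)
    (br : 'rV[R]_n -> 'rV[R]_n -> 'rV[R]_n) (x : 'rV[R]_n) (a : 'cV[R]_n) :
    'cV[R]_n :=
  \col_i pairing a (br x (delta_mx 0 i)).

Definition dual_bracket (R : realType) (n : nat)
    (br : 'rV[R]_n -> 'rV[R]_n -> 'rV[R]_n) (r : 'M[R]_n) (a b : 'cV[R]_n) :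
    'cV[R]_n :=
  coad br (r_sharp r b) a - coad br (r_sharp r a) b.

(* The Lie algebra of the oscillator group, with basis (e0, e1, e2, d) numbered
   from 0 to 3: [e1, e2] = e0, [d, e1] = e2, [d, e2] = - e1. *)
Definition osc_bracket (R : realType) (x y : 'rV[R]_4) : 'rV[R]_4 :=
  let x_ (k : nat) := x 0 (inord k) in
  let y_ (k : nat) := y 0 (inord k) in
  (x_ 1%N * y_ 2%N - x_ 2%N * y_ 1%N) *: delta_mx 0 (inord 0)
  - (x_ 3%N * y_ 2%N - x_ 2%N * y_ 3%N) *: delta_mx 0 (inord 1)
  + (x_ 3%N * y_ 1%N - x_ 1%N * y_ 3%N) *: delta_mx 0 (inord 2).

(* Main.v *)
Require Import Defs.
From HB Require Import structures.
From mathcomp Require Import all_boot all_order all_algebra.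
From mathcomp Require Import all_classical all_reals all_analysis.
From mathcomp Require Import ring lra.
Set Implicit Arguments.
Unset Strict Implicit.
Unset Printing Implicit Defensive.
Import Order.TTheory GRing.Theory Num.Theory.
Import numFieldNormedType.Exports.
Local Open Scope classical_set_scope.
Local Open Scope ring_scope.

(** The geometry is reduced to linear algebra on the Lie algebra.  A Lie group
    with a prescribed Lie algebra has a left invariant frame [E]
    ([has_lie_algebra_frame]), and a vector field [X] is determined by the row
    [frame_coef E X] of its coefficients in [E].  The field is smooth exactly
    when this row is ([smooth_coef], [smooth_vf_comb]), and a left translation
    acts on it by precomposition ([coef_ltransE]).  Hence a bilinear form with
    constant Gram matrix in the frame is left invariant, and so is the
    connection with coefficients X(y) + y B(x), where x and y are the
    coefficients of X and Y, and B is a linear map from the Lie algebra to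
    matrices.

    Two formulas turn the differential conditions into identities on the Lie
    algebra.  The coefficients of [X, Y] are X(y) - Y(x) + br(x, y)
    ([coef_bracket]), and [X, Y] f = X (Y f) - Y (X f) ([map_deriv_bracket]);
    the latter is the symmetry of second derivatives ([schwarz]).  The terms
    with derivatives then cancel in the torsion, in the curvature, in the
    exterior derivative of a form and in the compatibility with a metric, and
    what remains is: B induces the bracket, B represents it, B is skew for the
    metric, and the 2-form is a cocycle.

    For the oscillator algebra the equation forces r = e0 /\ v
    ([cybe_oscillator]): one of its components is the sum of two squares of
    entries of r, and another one is then the square of the last entry.  As e0
    is central, the vector attached by r to a form u acts like u_0 v, so that
    br(u, v) = u_0 (v A) - v_0 (u A), where - A is the coadjoint action of v
    ([dual_bracketE]).  The connection B(u) = u_0 A, which is the opposite of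
    the coadjoint action of the vector attached to u, induces this bracket.  It
    is flat because the values of A have no component on e0*: the operators
    B(u) are proportional, hence commute, and B vanishes on brackets.  The
    oscillator algebra has an invariant Lorentz form, given by
    <e0, d> = <e1, e1> = <e2, e2> = 1, and coadjoint operators are skew for the
    dual form; so the connection is the Levi-Civita connection of a flat
    Lorentz metric.  In the coordinates of the dual basis, the form
    u_0 v_3 - u_3 v_0 + u_1 v_2 - u_2 v_1 is a cocycle since, modulo d*, A acts
    on the span of e1* and e2* as an infinitesimal rotation. *)

(** * Differentials *)

Section Differentials.
Context {R : realType}.
Implicit Types U V W : normedModType R.

(** The little-o expansion of [f] at [x] only depends on the germ of [f], so it
    is also one of [g]. *)
Lemma near_eq_differentiable V W (f g : V -> W) x :
  {near x, f =1 g} -> differentiable f x -> differentiable g x.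
Proof.
move=> fg df; have fgx := nbhs_singleton fg.
have cdf := diff_continuous df.
have e : g \o shift x = cst (g x) + 'd f x +o_ 0 id.
  apply/eqaddoP => eps eps0.
  have /eqaddoP/(_ eps eps0) := diff_locally df.
  have : \forall y \near 0, f (y + x) = g (y + x).
    move: fg; rewrite [\forall y \near x, _](near_shift 0) subr0 /=.
    by apply: filterS => y.
  by apply: filterS2 => y fgy; rewrite /= !fctE /= fgy fgx.
by apply/diff_locallyP; rewrite (diff_unique cdf e).
Qed.

Lemma derive_comp U V W (f : U -> V) (g : V -> W) x v :
  differentiable f x -> differentiable g (f x) ->
  'D_v (g \o f) x = 'D_('D_v f x) g (f x).
Proof.
move=> df dg; rewrite (deriveE _ df) (deriveE _ dg).
by rewrite (deriveE _ (differentiable_comp df dg)) diff_comp.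
Qed.

Lemma deriveZD V W (f : V -> W) x (k : R) u v : differentiable f x ->
  'D_(k *: u + v) f x = k *: 'D_u f x + 'D_v f x.
Proof. by move=> df; rewrite !(deriveE _ df) linearP. Qed.

Lemma deriveBv V W (f : V -> W) x u v : differentiable f x ->
  'D_(u - v) f x = 'D_u f x - 'D_v f x.
Proof. by move=> df; rewrite !(deriveE _ df) linearB. Qed.

Lemma derive_sumv V W (f : V -> W) x (I : finType) (k : I -> R) (e : I -> V) :
  differentiable f x ->
  'D_(\sum_i k i *: e i) f x = \sum_i k i *: 'D_(e i) f x.
Proof.
move=> df; rewrite (deriveE _ df) linear_sum; apply: eq_bigr => i _.
by rewrite linearZ (deriveE _ df).
Qed.

Lemma differentiable_linear V W (L : V -> W) x :
  linear L -> continuous L -> differentiable L x.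
Proof.
move=> lL cL; pose LL : {linear V -> W} :=
  HB.pack L (GRing.isLinear.Build _ _ _ _ _ lL).
by rewrite (_ : L = LL) //; apply: linear_differentiable.
Qed.

Lemma derive_linear V W (L : V -> W) x v :
  linear L -> continuous L -> 'D_v L x = L v.
Proof.
move=> lL cL; rewrite deriveE; last exact: differentiable_linear.
pose LL : {linear V -> W} :=
  HB.pack L (GRing.isLinear.Build _ _ _ _ _ lL).
by rewrite (_ : L = LL) // diff_lin.
Qed.

Lemma differentiable_big V W (I : Type) (s : seq I) (f : I -> V -> W) x :
  (forall i, differentiable (f i) x) ->
  differentiable (fun y => \sum_(i <- s) f i y) x.
Proof.
move=> df; elim: s => [|i s IH].
  by under eq_fun do rewrite big_nil; exact: differentiable_cst.
under eq_fun do rewrite big_cons.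
exact: (differentiableD (df i) IH).
Qed.

(** In finite dimension a linear map is a combination of coordinate functions. *)
Lemma linear_rV_continuous n W (L : 'rV[R]_n -> W) : linear L -> continuous L.
Proof.
move=> lL x; apply: differentiable_continuous.
pose LL : {linear 'rV[R]_n -> W} :=
  HB.pack L (GRing.isLinear.Build _ _ _ _ _ lL).
have -> : L = (fun v : 'rV[R]_n => \sum_j v ord0 j *: LL (delta_mx 0 j)).
  apply/funext => v; rewrite -[LHS]/(LL v) {1}(row_sum_delta v) linear_sum.
  by apply: eq_bigr => j _; rewrite linearZ.
apply: differentiable_big => j.
by apply: differentiableZl; exact: differentiable_coord.
Qed.

Lemma differentiable_mx V m n (F : V -> 'M[R]_(m, n)) x :
  (forall i j, differentiable (fun y => F y i j) x) -> differentiable F x.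
Proof.
move=> dF.
rewrite (_ : F = fun y => \sum_i \sum_j F y i j *: delta_mx i j); last first.
  by apply/funext => y; rewrite {1}[F y]matrix_sum_delta.
apply: differentiable_big => i; apply: differentiable_big => j.
apply: differentiableZl; exact: dF.
Qed.

Lemma differentiable_entry V m n (F : V -> 'M[R]_(m, n)) x i j :
  differentiable F x -> differentiable (fun y => F y i j) x.
Proof.
move=> dF.
exact: (differentiable_comp (g := fun M : 'M[R]_(m, n) => M i j) dF
  (differentiable_coord _ _ _)).
Qed.

Lemma derive_entry V m n (F : V -> 'M[R]_(m, n)) x v i j :
  differentiable F x -> ('D_v F x) i j = 'D_v (fun y => F y i j) x.
Proof.
by move=> dF; rewrite derive_mx ?mxE//; exact: diff_derivable.
Qed.

Lemma derive_big V W (I : Type) (s : seq I) (f : I -> V -> W) x v :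
  (forall i, differentiable (f i) x) ->
  'D_v (fun y => \sum_(i <- s) f i y) x = \sum_(i <- s) 'D_v (f i) x.
Proof.
move=> df; elim: s => [|i s IH].
  under eq_fun do rewrite big_nil; rewrite big_nil; exact: derive_cst.
under eq_fun do rewrite big_cons.
rewrite big_cons -IH; apply: deriveD; apply: diff_derivable => //.
exact: differentiable_big.
Qed.

Lemma differentiable_mulmx V m n p (A : V -> 'M[R]_(m, n)) (B : V -> 'M[R]_(n, p))
    x : differentiable A x -> differentiable B x ->
  differentiable (fun y => A y *m B y) x.
Proof.
move=> dA dB; apply: differentiable_mx => i j.
under eq_fun do rewrite mxE.
apply: differentiable_big => k.
by apply: differentiableM; exact: differentiable_entry.
Qed.

Lemma derive_mulmx V m n p (A : V -> 'M[R]_(m, n)) (B : V -> 'M[R]_(n, p)) x v :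
  differentiable A x -> differentiable B x ->
  'D_v (fun y => A y *m B y) x = 'D_v A x *m B x + A x *m 'D_v B x.
Proof.
move=> dA dB; apply/matrixP => i j.
rewrite derive_entry; last exact: differentiable_mulmx.
under eq_fun do rewrite mxE.
have dM k : differentiable (fun y => A y i k * B y k j) x.
  by apply: differentiableM; exact: differentiable_entry.
rewrite derive_big // !mxE -big_split; apply: eq_bigr => k _ /=.
rewrite (_ : (fun y => _) = (fun y => A y i k) * (fun y => B y k j)) //.
rewrite deriveM ?(derive_entry _ _ _ dA, derive_entry _ _ _ dB); last 2 first.
- exact/diff_derivable/differentiable_entry.
- exact/diff_derivable/differentiable_entry.
by rewrite addrC; congr (_ + _); exact: mulrC.
Qed.

Lemma differentiable_scalemx V m n (f : V -> R) (A : V -> 'M[R]_(m, n)) x :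
  differentiable f x -> differentiable A x ->
  differentiable (fun y => f y *: A y) x.
Proof.
move=> df dA; apply: differentiable_mx => i j.
under eq_fun do rewrite mxE.
by apply: differentiableM => //; exact: differentiable_entry.
Qed.

Lemma derive_scalemx V m n (f : V -> R) (A : V -> 'M[R]_(m, n)) x v :
  differentiable f x -> differentiable A x ->
  'D_v (fun y => f y *: A y) x = 'D_v f x *: A x + f x *: 'D_v A x.
Proof.
move=> df dA; apply/matrixP => i j.
rewrite derive_entry; last exact: differentiable_scalemx.
under eq_fun do rewrite mxE.
rewrite (_ : (fun y => _) = f * (fun y => A y i j)) // deriveM; last 2 first.
- exact: diff_derivable.
- exact/diff_derivable/differentiable_entry.
rewrite !mxE (derive_entry _ _ _ dA) [LHS]addrC; congr (_ + _); exact: mulrC.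
Qed.

End Differentials.

(** * Smooth functions on an open set *)

Section SmoothOn.
Context {R : realType}.
Implicit Types V W : normedModType R.

Lemma times_differentiableW V W k (A : set V) (f : V -> W) :
  times_differentiable k.+1 A f -> times_differentiable k A f.
Proof.
elim: k f => [//|k IH] f [df Df]; split => // v.
exact/IH/Df.
Qed.

Lemma eq_times_differentiable V W k (A : set V) (f g : V -> W) :
  open A -> {in A, f =1 g} ->
  times_differentiable k A f -> times_differentiable k A g.
Proof.
move=> oA; elim: k f g => [//|k IH] f g fg [df Df].
have fgx x : A x -> {near x, f =1 g}.
  by move=> Ax; apply: filterS (open_nbhs_nbhs (conj oA Ax)) => y Ay;
     apply: fg; rewrite inE.
split=> [x Ax|v]; first exact: near_eq_differentiable (fgx x Ax) (df x Ax).
apply: IH (Df v) => x; rewrite inE => Ax.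
exact: near_eq_derive (fgx x Ax).
Qed.

(** A linear map commutes with the directional derivatives of its argument. *)
Lemma times_differentiable_linear V W W' k (A : set V) (f : V -> W) (L : W -> W') :
  open A -> linear L -> continuous L ->
  times_differentiable k A f -> times_differentiable k A (L \o f).
Proof.
move=> oA lL cL; elim: k f => [//|k IH] f [df Df].
have dL x : differentiable L x := differentiable_linear x lL cL.
split=> [x Ax|v]; first exact: (differentiable_comp (df x Ax) (dL _)).
apply: eq_times_differentiable (IH _ (Df v)) => // x; rewrite inE => Ax.
by rewrite (derive_comp _ (df x Ax) (dL _)) derive_linear.
Qed.

Lemma times_differentiable_cst V W k (A : set V) (w : W) :
  times_differentiable k A (cst w : V -> W).
Proof.
elim: k w => [//|k IH] w; split=> [x _|v]; first exact: differentiable_cst.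
by rewrite (_ : (fun x => _) = cst 0) //; apply/funext => x; exact: derive_cst.
Qed.

Lemma times_differentiableD V W k (A : set V) (f g : V -> W) : open A ->
  times_differentiable k A f -> times_differentiable k A g ->
  times_differentiable k A (fun x => f x + g x).
Proof.
move=> oA; elim: k f g => [//|k IH] f g [df Df] [dg Dg].
split=> [x Ax|v]; first exact: (differentiableD (df x Ax) (dg x Ax)).
apply: eq_times_differentiable (IH _ _ (Df v) (Dg v)) => // x; rewrite inE => Ax.
apply/esym/deriveD; exact: diff_derivable (df x Ax) || exact: diff_derivable (dg x Ax).
Qed.

Lemma times_differentiableM V k (A : set V) (f g : V -> R) : open A ->
  times_differentiable k A f -> times_differentiable k A g ->
  times_differentiable k A (fun x => f x * g x).
Proof.
move=> oA; elim: k f g => [//|k IH] f g tf tg.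
have [[df Df] [dg Dg]] := (tf, tg).
split=> [x Ax|v]; first exact: (differentiableM (df x Ax) (dg x Ax)).
have := times_differentiableD oA (IH _ _ (times_differentiableW tf) (Dg v))
  (IH _ _ (times_differentiableW tg) (Df v)).
apply: eq_times_differentiable => // x; rewrite inE => Ax.
by apply/esym/deriveM; [exact: diff_derivable (df x Ax)|
                        exact: diff_derivable (dg x Ax)].
Qed.

(** The derivative of 1/f is - (1/f)^2 f', so [k] derivatives of 1/f and [k.+1]
    of f provide [k.+1] derivatives of 1/f. *)
Lemma times_differentiable_inv V k (A : set V) (f : V -> R) : open A ->
  (forall x, A x -> f x != 0) ->
  times_differentiable k A f -> times_differentiable k A (fun x => (f x)^-1).
Proof.
move=> oA f0; elim: k => [//|k IH] tf; have [df Df] := tf.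
split=> [x Ax|v]; first exact: (differentiableV (df x Ax) (f0 x Ax)).
have tVf := IH (times_differentiableW tf).
have := times_differentiableM oA
  (times_differentiableM oA (times_differentiable_cst k A (- 1 : R)) tVf)
  (times_differentiableM oA tVf (Df v)).
apply: eq_times_differentiable => // x; rewrite inE => Ax.
rewrite deriveV ?f0//; last exact: diff_derivable (df x Ax).
rewrite /cst mulN1r mulNr mulrA scaleNr expr2 invfM.
by [].
Qed.

Lemma times_differentiable_mx V m n k (A : set V) (F : V -> 'M[R]_(m, n)) :
  open A -> (forall i j, times_differentiable k A (fun x => F x i j)) ->
  times_differentiable k A F.
Proof.
move=> oA; elim: k F => [//|k IH] F tF.
have dF x : A x -> differentiable F x.
  by move=> Ax; apply: differentiable_mx => i j; exact: (tF i j).1.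
split=> // v; apply: IH => i j.
apply: eq_times_differentiable ((tF i j).2 v) => // x; rewrite inE => Ax.
exact/esym/derive_entry/dF.
Qed.

Variables (V : normedModType R) (A : set V).
Hypothesis oA : open A.

Lemma eq_smooth_on W (f g : V -> W) :
  {in A, f =1 g} -> smooth_on A f -> smooth_on A g.
Proof. by move=> fg sf k; exact: eq_times_differentiable (sf k). Qed.

Lemma smooth_on_differentiable W (f : V -> W) x :
  smooth_on A f -> A x -> differentiable f x.
Proof. by move=> sf; apply: (sf 1%N).1. Qed.

Lemma smooth_on_derive W (f : V -> W) v :
  smooth_on A f -> smooth_on A (fun x => 'D_v f x).
Proof. by move=> sf k; exact: (sf k.+1).2. Qed.

Lemma smooth_on_linear W W' (f : V -> W) (L : W -> W') :
  linear L -> continuous L -> smooth_on A f -> smooth_on A (L \o f).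
Proof. by move=> lL cL sf k; exact: times_differentiable_linear. Qed.

Lemma smooth_on_cst W (w : W) : smooth_on A (fun=> w).
Proof. by move=> k; exact: times_differentiable_cst. Qed.

Lemma smooth_onD W (f g : V -> W) : smooth_on A f -> smooth_on A g ->
  smooth_on A (fun x => f x + g x).
Proof. by move=> sf sg k; exact: times_differentiableD. Qed.

Lemma smooth_onM (f g : V -> R) : smooth_on A f -> smooth_on A g ->
  smooth_on A (fun x => f x * g x).
Proof. by move=> sf sg k; exact: times_differentiableM. Qed.

Lemma smooth_on_sum W (I : Type) (s : seq I) (f : I -> V -> W) :
  (forall i, smooth_on A (f i)) -> smooth_on A (fun x => \sum_(i <- s) f i x).
Proof.
move=> sf; elim: s => [|i s IH].
  by under eq_fun do rewrite big_nil; exact: smooth_on_cst.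
by under eq_fun do rewrite big_cons; exact: smooth_onD.
Qed.

Lemma smooth_on_prod (I : Type) (s : seq I) (f : I -> V -> R) :
  (forall i, smooth_on A (f i)) -> smooth_on A (fun x => \prod_(i <- s) f i x).
Proof.
move=> sf; elim: s => [|i s IH].
  by under eq_fun do rewrite big_nil; exact: smooth_on_cst.
by under eq_fun do rewrite big_cons; exact: smooth_onM.
Qed.

Lemma smooth_on_inv (f : V -> R) : (forall x, A x -> f x != 0) ->
  smooth_on A f -> smooth_on A (fun x => (f x)^-1).
Proof. by move=> f0 sf k; exact: times_differentiable_inv. Qed.

Lemma smooth_on_mx m n (F : V -> 'M[R]_(m, n)) :
  (forall i j, smooth_on A (fun x => F x i j)) -> smooth_on A F.
Proof. by move=> sF k; apply: times_differentiable_mx => // i j; exact: sF. Qed.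

Lemma smooth_on_entry m n (F : V -> 'M[R]_(m, n)) i j :
  smooth_on A F -> smooth_on A (fun x => F x i j).
Proof.
apply: (smooth_on_linear (L := fun M : 'M[R]_(m, n) => M i j : R)).
  by move=> k M N; rewrite !mxE.
exact: coord_continuous.
Qed.

Lemma smooth_on_mulmx m n p (F : V -> 'M[R]_(m, n)) (G : V -> 'M[R]_(n, p)) :
  smooth_on A F -> smooth_on A G -> smooth_on A (fun x => F x *m G x).
Proof.
move=> sF sG; apply: smooth_on_mx => i j; under eq_fun do rewrite mxE.
by apply: smooth_on_sum => k; apply: smooth_onM; exact: smooth_on_entry.
Qed.

(** The determinant is a polynomial in the entries. *)
Lemma smooth_on_det n (F : V -> 'M[R]_n) :
  smooth_on A F -> smooth_on A (fun x => \det (F x)).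
Proof.
move=> sF; rewrite /determinant; apply: smooth_on_sum => s.
apply: smooth_onM; first exact: smooth_on_cst.
by apply: smooth_on_prod => i; exact: smooth_on_entry.
Qed.

(** Cramer's rule expresses the entries of the inverse by determinants. *)
Lemma smooth_on_invmx n (F : V -> 'M[R]_n) :
  (forall x, A x -> F x \in unitmx) ->
  smooth_on A F -> smooth_on A (fun x => invmx (F x)).
Proof.
move=> uF sF.
have sdet : smooth_on A (fun x => (\det (F x))^-1).
  apply: smooth_on_inv; last exact: smooth_on_det.
  by move=> x /uF; rewrite unitmxE unitfE.
apply: smooth_on_mx => i j.
have : smooth_on A (fun x => (\det (F x))^-1 * \adj (F x) i j).
  apply: smooth_onM => //.
  under eq_fun do rewrite mxE /cofactor.
  apply: smooth_onM; first exact: smooth_on_cst.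
  apply: smooth_on_det; apply: smooth_on_mx => k l.
  by under eq_fun do rewrite !mxE; exact: smooth_on_entry.
apply: eq_smooth_on => x; rewrite inE => Ax.
by rewrite /invmx uF // [RHS]mxE mxE.
Qed.

End SmoothOn.

(** * Symmetry of second derivatives *)

Section Schwarz.
Context {R : realType} {V : normedModType R}.
Implicit Types (A : set V) (f : V -> R).

Lemma is_derive_line f x v (t : R) : differentiable f (x + t *: v) ->
  is_derive t 1 (fun s : R => f (x + s *: v)) ('D_v f (x + t *: v)).
Proof.
move=> df; pose l (s : R) : V := x + s *: v.
have lv : linear (fun s : R => s *: v) by move=> k a b; rewrite scalerDl scalerA.
have cv : continuous (fun s : R => s *: v) by exact: scalel_continuous.
have dv : differentiable (fun s : R => s *: v) t by exact: differentiable_linear.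
have dl : differentiable l t by exact: differentiableD.
have Dl : 'D_1 l t = v.
  rewrite /l deriveD; [|exact: derivable_cst|exact: diff_derivable].
  by rewrite derive_cst add0r derive_linear // scale1r.
apply: DeriveDef; first exact/diff_derivable/(differentiable_comp dl df).
by rewrite (derive_comp _ dl df) Dl.
Qed.

Lemma MVT_line f x v (h : R) : 0 < h ->
  (forall t, 0 <= t <= h -> differentiable f (x + t *: v)) ->
  exists2 t, 0 <= t <= h & f (x + h *: v) - f x = h * 'D_v f (x + t *: v).
Proof.
move=> h0 df.
have [||t] := @MVT R (fun s : R => f (x + s *: v))
  (fun t => 'D_v f (x + t *: v)) 0 h h0.
- move=> t; rewrite in_itv /= => /andP[t0 th].
  by apply: is_derive_line; apply: df; rewrite !ltW.
- apply: derivable_within_continuous => t; rewrite in_itv /= => /df dft.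
  by have [] := is_derive_line dft.
rewrite in_itv /= scale0r addr0 subr0 => /andP[t0 th] e.
by exists t; [rewrite !ltW | rewrite e mulrC].
Qed.

Lemma differentiable_shift f w y : differentiable f (y + w) ->
  differentiable (fun z => f (z + w)) y.
Proof.
have ds : differentiable (fun z => z + w) y by exact: differentiableD.
exact: (differentiable_comp ds).
Qed.

Lemma derive_translate f w y u : differentiable f (y + w) ->
  'D_u (fun z => f (z + w)) y = 'D_u f (y + w).
Proof.
have ds : differentiable (fun z => z + w) y by exact: differentiableD.
move=> df; rewrite (derive_comp u ds df); congr ('D_ _ f _).
rewrite deriveD; [|exact: derivable_id|exact: derivable_cst].
by rewrite derive_id derive_cst addr0.
Qed.

(** The mean value theorem along [u], for the increment of [f] along [v],
    followed by the mean value theorem along [v] for ['D_u f]. *)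
Lemma second_difference A f x u v (h : R) : 0 < h ->
  smooth_on A f ->
  (forall s t : R, 0 <= s <= h -> 0 <= t <= h -> A (x + s *: u + t *: v)) ->
  exists s t : R, [/\ 0 <= s <= h, 0 <= t <= h &
    f (x + h *: u + h *: v) - f (x + h *: u) - (f (x + h *: v) - f x)
    = h * (h * 'D_v (fun y => 'D_u f y) (x + s *: u + t *: v))].
Proof.
move=> h0 sf Ah.
have h00 : 0 <= (0 : R) <= h by rewrite lexx ltW.
have hh : 0 <= h <= h by rewrite lexx ltW.
have dfh s : 0 <= s <= h -> differentiable f (x + s *: u + h *: v).
  by move=> sh; apply: (smooth_on_differentiable sf); exact: Ah.
have df0 s : 0 <= s <= h -> differentiable f (x + s *: u).
  move=> sh; apply: (smooth_on_differentiable sf).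
  by have := Ah s 0 sh h00; rewrite scale0r addr0.
have [s sh|s sh] :=
  @MVT_line (fun y => f (y + h *: v) - f y) x u h h0.
  apply: differentiableB; last exact: df0.
  exact/differentiable_shift/dfh.
rewrite /= deriveB; last 2 first.
- exact/diff_derivable/differentiable_shift/dfh.
- exact/diff_derivable/df0.
rewrite derive_translate; last exact: dfh.
have [t th|t th ->] := @MVT_line (fun y => 'D_u f y) (x + s *: u) v h h0.
  apply: (smooth_on_differentiable (smooth_on_derive u sf)); exact: Ah.
by exists s, t.
Qed.

(** The second difference of [f] is symmetric in [u] and [v], and by
    [second_difference] it is, up to the factor h^2, the value of either mixed
    derivative at some point close to [x]; both are continuous at [x]. *)
Lemma schwarz A f x u v : open A -> smooth_on A f -> A x ->
  'D_u (fun y => 'D_v f y) x = 'D_v (fun y => 'D_u f y) x.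
Proof.
move=> oA sf Ax.
pose F (y : V) : R := 'D_u (fun y => 'D_v f y) y.
pose G (y : V) : R := 'D_v (fun y => 'D_u f y) y.
have cF : {for x, continuous F}.
  apply: differentiable_continuous; apply: (smooth_on_differentiable _ Ax).
  exact/smooth_on_derive/smooth_on_derive.
have cG : {for x, continuous G}.
  apply: differentiable_continuous; apply: (smooth_on_differentiable _ Ax).
  exact/smooth_on_derive/smooth_on_derive.
apply/eqP; rewrite -subr_eq0 -normr_le0; apply/ler_addgt0Pl => e e0.
rewrite addr0.
have e2 : 0 < e / 2 by rewrite divr_gt0.
have nA : \forall y \near x, A y by exact: open_nbhs_nbhs.
move/cvgrPdist_lt: cF => /(_ _ e2) nF.
move/cvgrPdist_lt: cG => /(_ _ e2) nG.
have [d d0 xd] := (nbhs_ballP _ _).1 (filterI nA (filterI nF nG)).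
(* For h = d / c, every point x + s u + t v with 0 <= s, t <= h is in the ball
   of radius d; the summand 1 keeps [c] positive when u = v = 0. *)
pose c := `|u| + `|v| + 1.
have c0 : 0 < c by rewrite ltr_wpDl // addr_ge0.
pose h := d / c.
have h0 : 0 < h by rewrite divr_gt0.
have near_x u' v' s t : `|u'| + `|v'| + 1 = c -> 0 <= s <= h -> 0 <= t <= h ->
    ball x d (x + s *: u' + t *: v').
  move=> cE /andP[s0 sh] /andP[t0 th].
  rewrite -ball_normE /ball_ /= -addrA opprD addNKr normrN.
  rewrite (le_lt_trans (ler_normD _ _)) // !normrZ !ger0_norm //.
  rewrite (@le_lt_trans _ _ (h * (`|u'| + `|v'|))) //.
    by rewrite mulrDr lerD // ler_wpM2r.
  rewrite /h mulrAC ltr_pdivrMr // ltr_pM2l // -cE ltrDl //.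
have [|s [t [sh th sE]]] := @second_difference A f x u v h h0 sf.
  by move=> s t sh th; have [] := xd _ (near_x u v s t erefl sh th).
have cE : `|v| + `|u| + 1 = c by rewrite /c [`|v| + _]addrC.
have [|s' [t' [sh' th' sE']]] := @second_difference A f x v u h h0 sf.
  by move=> s' t' sh' th'; have [] := xd _ (near_x v u s' t' cE sh' th').
have FG : F (x + s' *: v + t' *: u) = G (x + s *: u + t *: v).
  apply: (mulfI (lt0r_neq0 h0)); apply: (mulfI (lt0r_neq0 h0)).
  apply: (etrans (esym sE')); apply: (etrans _ sE).
  by rewrite [x + h *: v + h *: u]addrAC !opprB !addrA addrAC
    [RHS]addrAC -!addrA; congr (_ + _); rewrite addrCA.
have [_ [Fx _]] := xd _ (near_x v u s' t' cE sh' th').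
have [_ [_ Gx]] := xd _ (near_x u v s t erefl sh th).
have -> : 'D_u (fun y => 'D_v f y) x - 'D_v (fun y => 'D_u f y) x =
    (F x - F (x + s' *: v + t' *: u)) - (G x - G (x + s *: u + t *: v)).
  by rewrite FG opprB subrKA.
apply: (le_trans (ler_normB _ _)); rewrite (splitr e).
exact: lerD (ltW Fx) (ltW Gx).
Qed.

End Schwarz.

(** * Vector fields in charts *)

Section Charts.
Context {R : realType} {n : nat} {M : manifoldType R n}.
Implicit Types (c : chart R n M) (p : M) (x u : 'rV[R]_n) (X Y : vfield M).
Implicit Types W : normedModType R.

Lemma chart_cod_open c : atlas c -> open (chart_cod c).
Proof. by move=> /atlas_chart[]. Qed.

Lemma chart_invK c p : atlas c -> chart_dom c p -> chart_inv c (c p) = p.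
Proof. by move=> /atlas_chart[_ _ cK _ _] /cK. Qed.

Lemma chart_funK c x : atlas c -> chart_cod c x -> c (chart_inv c x) = x.
Proof. by move=> ac [p cp <-]; rewrite chart_invK. Qed.

Lemma chart_inv_dom c x : atlas c -> chart_cod c x -> chart_dom c (chart_inv c x).
Proof. by move=> ac [p cp <-]; rewrite chart_invK. Qed.

Lemma chart_fun_cod c p : chart_dom c p -> chart_cod c (c p).
Proof. by exists p. Qed.

Lemma near_chart_dom c p : atlas c -> chart_dom c p -> \forall q \near p, chart_dom c q.
Proof. by move=> /atlas_chart[oc _ _ _ _] cp; exact: open_nbhs_nbhs. Qed.

Lemma near_chart_cod c x : atlas c -> chart_cod c x -> \forall y \near x, chart_cod c y.
Proof. by move=> /chart_cod_open o cx; exact: open_nbhs_nbhs. Qed.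

Lemma near_chart_inv c p (A : set M) : atlas c -> chart_dom c p ->
  nbhs p A -> \forall x \near c p, A (chart_inv c x).
Proof.
move=> ac cp nA; have [_ _ _ _ ci] := atlas_chart _ ac.
by apply: (ci _ (chart_fun_cod cp)); rewrite chart_invK.
Qed.

Lemma transition_differentiable c c' p : atlas c -> atlas c' ->
  chart_dom c p -> chart_dom c' p -> differentiable (c' \o chart_inv c) (c p).
Proof.
move=> ac ac' cp c'p; apply: (smooth_on_differentiable (atlas_smooth _ _ ac ac')).
by exists p.
Qed.

Section ChangeOfChart.
Context {W} {f : M -> W} {c c' : chart R n M} {p : M}.
Hypotheses (ac : atlas c) (ac' : atlas c').
Hypotheses (cp : chart_dom c p) (c'p : chart_dom c' p).
Hypothesis df : differentiable (f \o chart_inv c) (c p).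

Let near_comp : {near c' p, (f \o chart_inv c) \o (c \o chart_inv c')
  =1 f \o chart_inv c'}.
Proof.
apply: filterS (near_chart_inv ac' c'p (near_chart_dom ac cp)) => x cx.
by rewrite /= chart_invK.
Qed.

Let dt := transition_differentiable ac' ac c'p cp.

Let df' : differentiable (f \o chart_inv c) ((c \o chart_inv c') (c' p)).
Proof. by rewrite /= chart_invK. Qed.

(** Chain rule for the factorization of f o c'^-1 as (f o c^-1) o (c o c'^-1),
    which is only valid near [c' p]. *)
Lemma derive_change_chart u : 'D_u (f \o chart_inv c') (c' p) =
  'D_('D_u (c \o chart_inv c') (c' p)) (f \o chart_inv c) (c p).
Proof.
by rewrite -(near_eq_derive u near_comp) (derive_comp u dt df') /= chart_invK.
Qed.

End ChangeOfChart.

Lemma derive_chart_id c p u : atlas c -> chart_dom c p ->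
  'D_u (c \o chart_inv c) (c p) = u.
Proof.
move=> ac cp; rewrite -[RHS](derive_id (c p) u); apply: near_eq_derive.
apply: filterS (near_chart_cod ac (chart_fun_cod cp)) => x cx.
by rewrite /= chart_funK.
Qed.

(** The differential of a transition map has the differential of the opposite
    transition map as a left inverse. *)
Lemma derive_transition_inj c c' p u : atlas c -> atlas c' ->
  chart_dom c p -> chart_dom c' p ->
  'D_u (c' \o chart_inv c) (c p) = 0 -> u = 0.
Proof.
move=> ac ac' cp c'p Du0.
have dt := transition_differentiable ac' ac c'p cp.
by rewrite -(derive_chart_id u ac cp) (derive_change_chart ac' ac c'p cp dt) Du0
  derive0.
Qed.

(** In the preferred chart at [p] the coordinates of [X p] are [X p] itself,
    because tangent vectors at [p] are represented in this chart. *)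
Lemma vf_coord_at X p : vf_coord (chart_at p) X (chart_at p p) = X p.
Proof.
have [ac cp] := (chart_at_atlas p, chart_at_dom p).
by rewrite /vf_coord chart_invK // derive_chart_id.
Qed.

Definition smooth_map W (f : M -> W) :=
  forall c, atlas c -> smooth_on (chart_cod c) (f \o chart_inv c).

(** Unlike [vf_deriv], which is the case W = R, this applies to functions whose
    values are vectors or matrices, such as the coefficients of a vector field. *)
Definition map_deriv W X (f : M -> W) p : W :=
  'D_(X p) (f \o chart_inv (chart_at p)) (chart_at p p).

Lemma smooth_map_differentiable W (f : M -> W) c p : atlas c -> chart_dom c p ->
  smooth_map f -> differentiable (f \o chart_inv c) (c p).
Proof.
move=> ac cp sf; apply: (smooth_on_differentiable (sf _ ac)).
exact: chart_fun_cod.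
Qed.

Lemma smooth_map_differentiable_at W (f : M -> W) p :
  smooth_map f -> differentiable (f \o chart_inv (chart_at p)) (chart_at p p).
Proof.
by apply: smooth_map_differentiable;
  [exact: chart_at_atlas|exact: chart_at_dom].
Qed.

(** The derivative along a field can be computed in any chart, not only in the
    preferred chart at the point considered. *)
Lemma map_deriv_chart W X (f : M -> W) c x : smooth_map f ->
  atlas c -> chart_cod c x ->
  map_deriv X f (chart_inv c x) = 'D_(vf_coord c X x) (f \o chart_inv c) x.
Proof.
move=> sf ac cx; have cp := chart_inv_dom ac cx.
rewrite /map_deriv (derive_change_chart ac (chart_at_atlas _) cp (chart_at_dom _)).
  by rewrite (chart_funK ac cx).
exact: smooth_map_differentiable.
Qed.

Lemma smooth_map_entry k l (F : M -> 'M[R]_(k, l)) i j :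
  smooth_map F -> smooth_map (fun p => F p i j : R).
Proof.
by move=> sF c ac; apply: smooth_on_entry; [exact: chart_cod_open|exact: sF].
Qed.

Lemma smooth_map_mx k l (F : M -> 'M[R]_(k, l)) :
  (forall i j, smooth_map (fun p => F p i j : R)) -> smooth_map F.
Proof.
move=> sF c ac; apply: smooth_on_mx; first exact: chart_cod_open.
by move=> i j; exact: sF.
Qed.

Lemma map_deriv_entry k l X (F : M -> 'M[R]_(k, l)) p i j : smooth_map F ->
  (map_deriv X F p) i j = map_deriv X (fun q => F q i j : R) p.
Proof. by move=> sF; apply: derive_entry; exact: smooth_map_differentiable_at. Qed.

Lemma map_deriv_sum W c X (f : M -> W) x : smooth_map f -> atlas c -> chart_cod c x ->
  map_deriv X f (chart_inv c x) =
  \sum_i (vf_coord c X x) 0 i *: 'D_(delta_mx 0 i) (f \o chart_inv c) x.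
Proof.
move=> sf ac cx; rewrite (map_deriv_chart _ sf) // {1}[vf_coord c X x]row_sum_delta.
apply: derive_sumv.
exact: (smooth_on_differentiable (sf _ ac)).
Qed.

Lemma smooth_map_deriv_scalar X (f : M -> R) :
  smooth_vf X -> smooth_map f -> smooth_map (map_deriv X f).
Proof.
move=> sX sf c ac; have oc := chart_cod_open ac.
have : smooth_on (chart_cod c) (fun x => \sum_i (vf_coord c X x) 0 i *
    ('D_(delta_mx 0 i) (f \o chart_inv c) x : R)).
  apply: smooth_on_sum => // i; apply: smooth_onM => //.
    by apply: smooth_on_entry => //; exact: sX.
  exact/smooth_on_derive/sf.
apply: eq_smooth_on => // x; rewrite inE => cx.
by rewrite /= map_deriv_sum.
Qed.

Lemma smooth_map_deriv k l X (F : M -> 'M[R]_(k, l)) :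
  smooth_vf X -> smooth_map F -> smooth_map (map_deriv X F).
Proof.
move=> sX sF; apply: smooth_map_mx => i j.
rewrite (_ : (fun p => _) = map_deriv X (fun q => F q i j : R)).
  exact/smooth_map_deriv_scalar/smooth_map_entry.
by apply/funext => p; rewrite map_deriv_entry.
Qed.

(** In coordinates X (Y f) = X^i (d_i Y^j) d_j f + X^i Y^j d_i d_j f; the first
    sum is the derivative of f along the derivative of Y. *)
Lemma map_deriv_deriv X Y (f : M -> R) p :
  smooth_vf Y -> smooth_map f -> let c := chart_at p in
  map_deriv X (map_deriv Y f) p =
  'D_('D_(X p) (vf_coord c Y) (c p)) (f \o chart_inv c) (c p) +
  \sum_i \sum_j X p 0 i * (Y p 0 j *
    'D_(delta_mx 0 i) (fun x => 'D_(delta_mx 0 j) (f \o chart_inv c) x) (c p)).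
Proof.
move=> sY sf c; have [ac cp] := (chart_at_atlas p, chart_at_dom p).
have cc := chart_fun_cod cp.
have oc := chart_cod_open ac.
have sfc := sf _ ac; set F := f \o chart_inv c in sfc *.
have dY := smooth_on_differentiable (sY _ ac) cc.
have dDF i := smooth_on_differentiable (smooth_on_derive (delta_mx 0 i) sfc) cc.
have -> : map_deriv X (map_deriv Y f) p =
    'D_(X p) (fun x => \sum_j (vf_coord c Y x) 0 j * 'D_(delta_mx 0 j) F x) (c p).
  apply: near_eq_derive; apply: filterS (near_chart_cod ac cc) => x cx.
  by rewrite /= map_deriv_sum.
have dYi i : differentiable (fun x => (vf_coord c Y x) 0 i : R) (c p).
  exact: differentiable_entry.
rewrite derive_big; last by move=> i; apply: differentiableM.
rewrite {1}['D_(X p) (vf_coord c Y) (c p)]row_sum_delta derive_sumv; last first.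
  exact: (smooth_on_differentiable sfc).
rewrite exchange_big -big_split; apply: eq_bigr => j _ /=.
rewrite (_ : (fun x => _) =
  (fun x => (vf_coord c Y x) 0 j : R) * 'D_(delta_mx 0 j) F) //.
rewrite deriveM; [|exact: diff_derivable|exact: diff_derivable].
rewrite -(derive_entry (X p) 0 j dY) vf_coord_at [LHS]addrC.
congr (_ + _); first exact: mulrC.
rewrite {1}[X p]row_sum_delta derive_sumv // scaler_sumr; apply: eq_bigr => i _.
exact: mulrCA.
Qed.

(** In [map_deriv_deriv] the second order terms are symmetric in [X] and [Y], by
    [schwarz], and the first order terms add up to the bracket. *)
Lemma map_deriv_bracket_scalar X Y (f : M -> R) p :
  smooth_vf X -> smooth_vf Y -> smooth_map f ->
  map_deriv (vf_bracket X Y) f p =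
  map_deriv X (map_deriv Y f) p - map_deriv Y (map_deriv X f) p.
Proof.
move=> sX sY sf; have [ac cp] := (chart_at_atlas p, chart_at_dom p).
rewrite (map_deriv_deriv _ _ sY sf) (map_deriv_deriv _ _ sX sf).
rewrite {1}/map_deriv /vf_bracket deriveBv; last exact: smooth_map_differentiable_at.
rewrite opprD [RHS]addrACA -[LHS]addr0; congr (_ + _); apply/esym.
apply/eqP; rewrite subr_eq0 exchange_big; apply/eqP.
apply: eq_bigr => i _; apply: eq_bigr => j _.
have e := schwarz (delta_mx 0 i) (delta_mx 0 j) (chart_cod_open ac)
  (sf _ ac) (chart_fun_cod cp).
apply: (etrans _ (congr1 (fun z : R => Y p 0 i * (X p 0 j * z)) (esym e))).
exact: mulrCA.
Qed.

Lemma map_deriv_bracket k l X Y (F : M -> 'M[R]_(k, l)) p :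
  smooth_vf X -> smooth_vf Y -> smooth_map F ->
  map_deriv (vf_bracket X Y) F p =
  map_deriv X (map_deriv Y F) p - map_deriv Y (map_deriv X F) p.
Proof.
move=> sX sY sF; apply/matrixP => i j; rewrite !mxE.
have E Z : (fun q => map_deriv Z F q i j) = map_deriv Z (fun q => F q i j : R).
  by apply/funext => q; rewrite map_deriv_entry.
have eX := map_deriv_entry X p i j (smooth_map_deriv sY sF).
have eY := map_deriv_entry Y p i j (smooth_map_deriv sX sF).
rewrite E in eX; rewrite E in eY.
apply: (etrans _ (esym (congr2 (fun a b => a - b) eX eY))).
apply: (etrans (map_deriv_entry _ p i j sF)).
exact/map_deriv_bracket_scalar/smooth_map_entry.
Qed.

End Charts.

(** * Left translations and left invariant frames *)

Section LeftTranslations.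
Context {R : realType} {n : nat} {G : lieGroupType R n}.
Implicit Types (a p q : G) (u v : 'rV[R]_n) (X Y : vfield G).
Implicit Types W : normedModType R.

Lemma ltrans_continuous a : continuous (ltrans a).
Proof.
move=> q; apply: (@continuous_comp _ _ _ (fun q => (a, q))
  (fun pq : G * G => (pq.1 * pq.2)%g)); last exact: Defs.mul_continuous.
by apply: cvg_pair; [exact: cvg_cst|exact: cvg_id].
Qed.

(** Left translation by [a] is the product restricted to the slice where the first
    factor is [a]. *)
Lemma ltrans_differentiable a p :
  differentiable (chart_at (ltrans a p) \o ltrans a \o chart_inv (chart_at p))
    (chart_at p p).
Proof.
have ac q : atlas (chart_at q) := chart_at_atlas q.
have cd q := chart_at_dom q.
pose i (y : 'rV[R]_n) := (chart_at a a, y).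
have di : differentiable i (chart_at p p).
  by apply: differentiable_pair; [exact: differentiable_cst|exact: ex_diff].
pose F (xy : 'rV[R]_n * 'rV[R]_n) := chart_at (ltrans a p)
  (chart_inv (chart_at a) xy.1 * chart_inv (chart_at p) xy.2)%g.
have dF : differentiable F (i (chart_at p p)).
  apply: (smooth_on_differentiable
    (mul_smooth (chart_at a) (chart_at p) (chart_at (ltrans a p)) _ _ _)) => //.
  split; [exact: chart_fun_cod|exact: chart_fun_cod|].
  by rewrite /i /= !chart_invK.
rewrite (_ : _ \o _ = F \o i); first exact: differentiable_comp.
by apply/funext => y; rewrite /F /i /= chart_invK.
Qed.

Lemma tangent_map0 a p : tangent_map (ltrans a) p 0 = 0.
Proof. exact: derive0. Qed.

Section Precomposition.
Context {W} {h : G -> W} {a p : G}.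
Hypothesis dh : differentiable (h \o chart_inv (chart_at (ltrans a p)))
  (chart_at (ltrans a p) (ltrans a p)).

Let T := chart_at (ltrans a p) \o ltrans a \o chart_inv (chart_at p).

Let TE : T (chart_at p p) = chart_at (ltrans a p) (ltrans a p).
Proof. by rewrite /T /= chart_invK //; [exact: chart_at_atlas|exact: chart_at_dom]. Qed.

Let dhT : differentiable (h \o chart_inv (chart_at (ltrans a p))) (T (chart_at p p)).
Proof. by rewrite TE. Qed.

Let near_comp : {near chart_at p p, (h \o chart_inv (chart_at (ltrans a p))) \o T
  =1 (h \o ltrans a) \o chart_inv (chart_at p)}.
Proof.
have nd := near_chart_dom (chart_at_atlas (ltrans a p)) (chart_at_dom _).
have := near_chart_inv (chart_at_atlas p) (chart_at_dom p) (ltrans_continuous nd).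
apply: filterS => y cy; rewrite /T /= chart_invK //; exact: chart_at_atlas.
Qed.

Lemma differentiable_ltrans_comp :
  differentiable ((h \o ltrans a) \o chart_inv (chart_at p)) (chart_at p p).
Proof.
exact: near_eq_differentiable near_comp
  (differentiable_comp (ltrans_differentiable a p) dhT).
Qed.

(** Chain rule for the composition of [h] with a left translation. *)
Lemma derive_tangent_map v : 'D_(tangent_map (ltrans a) p v)
    (h \o chart_inv (chart_at (ltrans a p))) (chart_at (ltrans a p) (ltrans a p)) =
  'D_v ((h \o ltrans a) \o chart_inv (chart_at p)) (chart_at p p).
Proof.
rewrite -(near_eq_derive v near_comp).
by rewrite (derive_comp (f := T) v (ltrans_differentiable a p) dhT) TE.
Qed.

End Precomposition.

Lemma map_deriv_ltrans W X (f : G -> W) a q : smooth_map f ->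
  map_deriv (ltrans_vf a X) (f \o ltrans a^-1%g) (a * q)%g = map_deriv X f q.
Proof.
move=> sf.
have df p := smooth_map_differentiable_at p sf.
rewrite /map_deriv /ltrans_vf mulKg (derive_tangent_map (h := f \o ltrans a^-1%g)).
  rewrite (_ : (f \o ltrans a^-1%g) \o ltrans a = f) //.
  by apply/funext => y; rewrite /= /ltrans mulKg.
exact/differentiable_ltrans_comp/df.
Qed.

End LeftTranslations.

Section LeftInvariantFrames.
Context {R : realType} {n : nat} {G : lieGroupType R n}.

(** The rows of [E p] are the values at [p] of the fields of the frame. *)
Definition left_invariant_frame (E : G -> 'M[R]_n) :=
  [/\ forall p, E p \in unitmx,
      forall u, smooth_vf (fun p => u *m E p) &
      forall a p u, u *m E (a * p)%g = tangent_map (ltrans a) p (u *m E p)].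

(** A left invariant field vanishing at one point vanishes everywhere, by
    translation.  As [Phi] is injective, the fields attached to a basis of the Lie
    algebra are therefore independent at every point. *)
Lemma has_lie_algebra_frame (br : 'cV[R]_n -> 'cV[R]_n -> 'cV[R]_n) :
  has_lie_algebra G br ->
  exists2 E : G -> 'M[R]_n, left_invariant_frame E &
    forall u v, vf_bracket (fun p => u *m E p) (fun p => v *m E p) =
                fun p => (br u^T v^T)^T *m E p.
Proof.
move=> [Phi [Plin Pinj Prange Pbr]].
pose E p := \matrix_(i < n) Phi (delta_mx i 0) p.
have P0 p : Phi 0 p = 0 by have := Plin (-1) 0 0 p;
  rewrite scaleN1r addNr scaleN1r addNr.
have PE a : Phi a = fun p => a^T *m E p.
  apply/funext => p; rewrite mulmx_sum_row.
  have PL : linear (fun b => Phi b p) by move=> k b c; exact: Plin.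
  pose L : {linear 'cV[R]_n -> 'rV[R]_n} :=
    HB.pack (fun b => Phi b p) (GRing.isLinear.Build _ _ _ _ _ PL).
  rewrite -[Phi a p]/(L a) {1}(matrix_sum_delta a) linear_sum.
  apply: eq_bigr => i _; rewrite big_ord1 linearZ rowK mxE /=.
  by congr (a _ _ *: _).
have EP u : (fun p => u *m E p) = Phi u^T by rewrite PE trmxK.
have PI a : left_invariant_vf (Phi a).
  by have : range Phi (Phi a) by [exists a]; rewrite Prange.
exists E; last by move=> u v; rewrite !EP -Pbr PE.
split.
- move=> p; rewrite -row_free_unit; apply: inj_row_free => u uE.
  suff : Phi u^T = Phi 0 by move/Pinj/(congr1 trmx); rewrite trmxK trmx0.
  apply/funext => q; rewrite P0 -(mulgVK p q).
  have [_ ->] := PI u^T.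
  by rewrite PE trmxK uE tangent_map0.
- by move=> u; rewrite EP; have [] := PI u^T.
- move=> a p u; have [_ /(_ a p)] := PI u^T.
  by rewrite PE trmxK.
Qed.

Variable E : G -> 'M[R]_n.
Hypothesis FE : left_invariant_frame E.
Implicit Types (a p q : G) (u v : 'rV[R]_n) (X Y : vfield G).

Definition frame_coef X p : 'rV[R]_n := X p *m invmx (E p).

Lemma frame_unit p : E p \in unitmx.
Proof. by case: FE. Qed.

Lemma coefK X p : frame_coef X p *m E p = X p.
Proof. by rewrite mulmxKV ?frame_unit. Qed.

Lemma coef_comb (k : G -> 'rV[R]_n) p : frame_coef (fun q => k q *m E q) p = k p.
Proof. by rewrite /frame_coef mulmxK ?frame_unit. Qed.

Definition frame_coord (c : chart R n G) (x : 'rV[R]_n) : 'M[R]_n :=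
  \matrix_(i < n) vf_coord c (fun p => delta_mx 0 i *m E p) x.

Lemma vf_coord_frame c X x : atlas c -> chart_cod c x ->
  vf_coord c X x = frame_coef X (chart_inv c x) *m frame_coord c x.
Proof.
move=> ac cx; rewrite mulmx_sum_row {1}/vf_coord -{1}(coefK X).
set k := frame_coef X _; rewrite {1}(row_sum_delta k) mulmx_suml.
rewrite (eq_bigr _ (fun i _ => esym (scalemxAl _ _ _))) derive_sumv.
  by apply: eq_bigr => i _; rewrite rowK.
apply: (transition_differentiable (chart_at_atlas _) ac (chart_at_dom _)).
exact: chart_inv_dom.
Qed.

(** Transition maps have injective differentials, so the frame remains a basis in
    the coordinates of any chart. *)
Lemma frame_coord_unit c x : atlas c -> chart_cod c x -> frame_coord c x \in unitmx.
Proof.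
move=> ac cx; rewrite -row_free_unit; apply: inj_row_free => u uF.
have := vf_coord_frame (fun p => u *m E p) ac cx; rewrite coef_comb uF => D0.
have uE : u *m E (chart_inv c x) = 0.
  apply: derive_transition_inj D0;
  [exact: chart_at_atlas|exact: ac|exact: chart_at_dom|exact: chart_inv_dom].
by rewrite -[u](mulmxK (frame_unit (chart_inv c x))) uE mul0mx.
Qed.

Lemma smooth_frame_coord c : atlas c -> smooth_on (chart_cod c) (frame_coord c).
Proof.
move=> ac; have oc := chart_cod_open ac.
apply: smooth_on_mx => // i j; under eq_fun do rewrite mxE.
by apply: smooth_on_entry => //; have [_ + _] := FE; apply.
Qed.

(** In a chart, the coefficients solve a linear system whose matrix
    [frame_coord E c] is smooth and invertible. *)
Lemma smooth_coef X : smooth_vf X -> smooth_map (frame_coef X).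
Proof.
move=> sX c ac; have oc := chart_cod_open ac.
have : smooth_on (chart_cod c) (fun x => vf_coord c X x *m invmx (frame_coord c x)).
  apply: smooth_on_mulmx => //; first exact: sX.
  apply: smooth_on_invmx => //; last exact: smooth_frame_coord.
  by move=> x; exact: frame_coord_unit.
apply: eq_smooth_on => // x; rewrite inE => cx.
by rewrite /= vf_coord_frame // mulmxK // frame_coord_unit.
Qed.

Lemma smooth_vf_comb (k : G -> 'rV[R]_n) :
  smooth_map k -> smooth_vf (fun p => k p *m E p).
Proof.
move=> sk c ac; have oc := chart_cod_open ac.
have : smooth_on (chart_cod c) (fun x => k (chart_inv c x) *m frame_coord c x).
  by apply: smooth_on_mulmx => //; [exact: sk|exact: smooth_frame_coord].
apply: eq_smooth_on => // x; rewrite inE => cx.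
by rewrite vf_coord_frame // coef_comb.
Qed.

Lemma coef_ltrans a X q : frame_coef (ltrans_vf a X) (a * q)%g = frame_coef X q.
Proof.
have [_ _ Einv] := FE.
by rewrite /frame_coef /ltrans_vf mulKg -{1}(coefK X) -Einv mulmxK ?frame_unit.
Qed.

Lemma coef_ltransE a X : frame_coef (ltrans_vf a X) = frame_coef X \o ltrans a^-1%g.
Proof.
by apply/funext => p; rewrite -{1}(mulVKg a p) coef_ltrans.
Qed.

Lemma frame_coord_at p : frame_coord (chart_at p) (chart_at p p) = E p.
Proof. by apply/row_matrixP => i; rewrite rowK vf_coord_at rowE. Qed.

Lemma derive_vf_coord Y p v : smooth_vf Y -> let c := chart_at p in
  'D_v (vf_coord c Y) (c p) = 'D_v (frame_coef Y \o chart_inv c) (c p) *m E p +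
    frame_coef Y p *m 'D_v (frame_coord c) (c p).
Proof.
move=> sY c; have [ac cp] := (chart_at_atlas p, chart_at_dom p).
have cc := chart_fun_cod cp.
have -> : 'D_v (vf_coord c Y) (c p) =
    'D_v (fun x => (frame_coef Y \o chart_inv c) x *m frame_coord c x) (c p).
  apply: near_eq_derive; apply: filterS (near_chart_cod ac cc) => x cx.
  by rewrite vf_coord_frame.
rewrite derive_mulmx; last 2 first.
- exact/smooth_map_differentiable_at/smooth_coef.
- exact: smooth_on_differentiable (smooth_frame_coord ac) cc.
by rewrite frame_coord_at /= chart_invK.
Qed.

Lemma derive_vf_coord_const u p v : let c := chart_at p in
  'D_v (vf_coord c (fun q => u *m E q)) (c p) = u *m 'D_v (frame_coord c) (c p).
Proof.
move=> c; have [_ Esm _] := FE.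
rewrite (derive_vf_coord _ _ (Esm u)) coef_comb.
rewrite (_ : frame_coef _ = cst u); last by apply/funext => q; rewrite coef_comb.
by rewrite (derive_cst (V := 'rV[R]_n) u) mul0mx add0r.
Qed.

(** Derivatives of the frame enter [vf_bracket X Y p] only through the values of
    [X] and [Y] at [p].  Their contribution is thus the bracket at [p] of the two
    fields with constant coefficients [frame_coef E X p] and [frame_coef E Y p]. *)
Lemma coef_bracket (br : 'rV[R]_n -> 'rV[R]_n -> 'rV[R]_n) X Y p :
  (forall u v, vf_bracket (fun p => u *m E p) (fun p => v *m E p) =
               fun p => br u v *m E p) ->
  smooth_vf X -> smooth_vf Y ->
  frame_coef (vf_bracket X Y) p =
    map_deriv X (frame_coef Y) p - map_deriv Y (frame_coef X) p
    + br (frame_coef X p) (frame_coef Y p).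
Proof.
move=> Ebr sX sY.
have brE : br (frame_coef X p) (frame_coef Y p) *m E p =
    frame_coef Y p *m 'D_(X p) (frame_coord (chart_at p)) (chart_at p p) -
    frame_coef X p *m 'D_(Y p) (frame_coord (chart_at p)) (chart_at p p).
  apply: (etrans (esym (congr1 (fun Z => Z p)
    (Ebr (frame_coef X p) (frame_coef Y p))))).
  have /= eY := derive_vf_coord_const (frame_coef Y p) p (frame_coef X p *m E p).
  have /= eX := derive_vf_coord_const (frame_coef X p) p (frame_coef Y p *m E p).
  by rewrite /vf_bracket /= eX eY !coefK.
have BE : vf_bracket X Y p =
    (map_deriv X (frame_coef Y) p - map_deriv Y (frame_coef X) p
    + br (frame_coef X p) (frame_coef Y p)) *m E p.
  rewrite mulmxDl brE mulmxBl /vf_bracket.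
  rewrite (derive_vf_coord _ _ sX) (derive_vf_coord _ _ sY).
  by rewrite opprD addrACA.
by rewrite [frame_coef (vf_bracket X Y) p]/frame_coef BE mulmxK ?frame_unit.
Qed.

End LeftInvariantFrames.

(** * Left invariant forms and connections *)

Section SmoothMaps.
Context {R : realType} {n : nat} {M : manifoldType R n}.
Implicit Types (X Y : vfield M) (p : M).

Lemma smooth_map_cst (W : normedModType R) (w : W) : smooth_map (cst w : M -> W).
Proof. by move=> c ac; exact: smooth_on_cst. Qed.

Lemma smooth_mapD (W : normedModType R) (f g : M -> W) : smooth_map f -> smooth_map g ->
  smooth_map (fun p => f p + g p).
Proof.
by move=> sf sg c ac; exact: (smooth_onD (chart_cod_open ac) (sf _ ac) (sg _ ac)).
Qed.

Lemma smooth_map_mulmx k l m (F : M -> 'M[R]_(k, l)) (H : M -> 'M[R]_(l, m)) :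
  smooth_map F -> smooth_map H -> smooth_map (fun p => F p *m H p).
Proof.
move=> sF sH c ac.
exact: (smooth_on_mulmx (chart_cod_open ac) (sF _ ac) (sH _ ac)).
Qed.

Lemma smooth_map_linear (W W' : normedModType R) (f : M -> W) (L : W -> W') :
  linear L -> continuous L -> smooth_map f -> smooth_map (L \o f).
Proof.
move=> lL cL sf c ac.
exact: (smooth_on_linear (chart_cod_open ac) lL cL (sf _ ac)).
Qed.

Lemma map_derivD (W : normedModType R) X (f g : M -> W) p :
  smooth_map f -> smooth_map g ->
  map_deriv X (fun q => f q + g q) p = map_deriv X f p + map_deriv X g p.
Proof.
move=> sf sg; apply: deriveD; apply: diff_derivable;
exact: smooth_map_differentiable_at.
Qed.

Lemma map_deriv_mulmx k l m X (F : M -> 'M[R]_(k, l)) (H : M -> 'M[R]_(l, m)) p :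
  smooth_map F -> smooth_map H ->
  map_deriv X (fun q => F q *m H q) p =
  map_deriv X F p *m H p + F p *m map_deriv X H p.
Proof.
move=> sF sH.
have [ac cp] := (chart_at_atlas p, chart_at_dom p).
have := derive_mulmx (X p) (smooth_map_differentiable_at p sF)
  (smooth_map_differentiable_at p sH).
by rewrite /= chart_invK.
Qed.

Lemma map_deriv_scale k l X (f : M -> R) (F : M -> 'M[R]_(k, l)) p :
  smooth_map f -> smooth_map F ->
  map_deriv X (fun q => f q *: F q) p = map_deriv X f p *: F p + f p *: map_deriv X F p.
Proof.
move=> sf sF.
have [ac cp] := (chart_at_atlas p, chart_at_dom p).
have := derive_scalemx (X p) (smooth_map_differentiable_at p sf)
  (smooth_map_differentiable_at p sF).
by rewrite /= chart_invK.
Qed.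

Lemma map_deriv_linear (W W' : normedModType R) X (f : M -> W) (L : W -> W') p :
  linear L -> continuous L -> smooth_map f ->
  map_deriv X (L \o f) p = L (map_deriv X f p).
Proof.
move=> lL cL sf; have df := smooth_map_differentiable_at p sf.
apply: (etrans (derive_comp _ df (differentiable_linear _ lL cL))).
exact: derive_linear.
Qed.

Lemma map_deriv_addv (W : normedModType R) X Y (f : M -> W) p : smooth_map f ->
  map_deriv (vf_add X Y) f p = map_deriv X f p + map_deriv Y f p.
Proof.
move=> sf; have df := smooth_map_differentiable_at p sf.
have := deriveZD 1 (X p) (Y p) df.
by rewrite !scale1r.
Qed.

Lemma map_deriv_scalev (W : normedModType R) (k : M -> R) X (f : M -> W) p :
  smooth_map f -> map_deriv (vf_scale k X) f p = k p *: map_deriv X f p.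
Proof.
move=> sf; have df := smooth_map_differentiable_at p sf.
have := deriveZD (k p) (X p) 0 df.
by rewrite derive0 !addr0.
Qed.

Lemma trmx_rV_continuous k : continuous (@trmx R 1 k : 'rV[R]_k -> 'cV[R]_k).
Proof. by apply: linear_rV_continuous => a x y; exact: linearP. Qed.

Lemma smooth_map_tr k (F : M -> 'rV[R]_k) :
  smooth_map F -> smooth_map (fun p => (F p)^T).
Proof.
apply: (smooth_map_linear (L := @trmx R 1 k)); last exact: trmx_rV_continuous.
by move=> a x y; exact: linearP.
Qed.

Lemma map_deriv_tr k X (F : M -> 'rV[R]_k) p :
  smooth_map F -> map_deriv X (fun q => (F q)^T) p = (map_deriv X F p)^T.
Proof.
move=> sF; apply: (@map_deriv_linear 'rV[R]_k 'cV[R]_k X F (@trmx R 1 k) p) => //.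
  by move=> a x y; exact: linearP.
exact: trmx_rV_continuous.
Qed.

End SmoothMaps.

Section InvariantStructures.
Context {R : realType} {n : nat} {G : lieGroupType R n}.
Variable E : G -> 'M[R]_n.
Hypothesis FE : left_invariant_frame E.
Variable br : 'rV[R]_n -> 'rV[R]_n -> 'rV[R]_n.
Hypothesis Ebr : forall u v, vf_bracket (fun p => u *m E p) (fun p => v *m E p) =
  fun p => br u v *m E p.
Implicit Types (a p q : G) (u v w : 'rV[R]_n) (X Y Z : vfield G).

Let coef := frame_coef E.

Section Forms.
Variable Q : 'M[R]_n.

(** The form whose Gram matrix in the frame is [Q] at every point. *)
Definition invariant_form : form_field G :=
  fun p => invmx (E p) *m Q *m (invmx (E p))^T.

Lemma form_eval_coef X Y p : form_eval invariant_form X Y p =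
  (coef X p *m Q *m (coef Y p)^T) 0 0.
Proof. by rewrite /form_eval /coef /frame_coef trmx_mul !mulmxA. Qed.

Let eval_map X Y p : 'M[R]_1 := coef X p *m Q *m (coef Y p)^T.

Let smooth_eval_map X Y : smooth_vf X -> smooth_vf Y -> smooth_map (eval_map X Y).
Proof.
move=> sX sY; apply: smooth_map_mulmx; last exact/smooth_map_tr/smooth_coef.
by apply: smooth_map_mulmx; [exact: smooth_coef|exact: smooth_map_cst].
Qed.

Lemma smooth_invariant_form : smooth_form invariant_form.
Proof.
move=> X Y sX sY.
rewrite (_ : form_eval _ X Y = fun p => eval_map X Y p 0 0 : R).
  exact/smooth_map_entry/smooth_eval_map.
by apply/funext => p; exact: form_eval_coef.
Qed.

Lemma left_invariant_invariant_form : left_invariant_form invariant_form.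
Proof.
move=> a p u v; have [_ _ Einv] := FE.
have tE x : tangent_map (ltrans a) p x *m invmx (E (a * p)%g) = x *m invmx (E p).
  by rewrite -{1}[x](mulmxKV (frame_unit FE p)) -Einv mulmxK ?frame_unit.
rewrite /invariant_form !mulmxA tE -mulmxA -trmx_mul tE.
by rewrite -[in RHS]mulmxA -trmx_mul.
Qed.

Lemma vf_deriv_form_eval X Y Z p : smooth_vf Y -> smooth_vf Z ->
  vf_deriv X (form_eval invariant_form Y Z) p =
  (map_deriv X (coef Y) p *m Q *m (coef Z p)^T) 0 0 +
  (coef Y p *m Q *m (map_deriv X (coef Z) p)^T) 0 0.
Proof.
move=> sY sZ; have sy := smooth_coef FE sY; have sz := smooth_coef FE sZ.
have sQ : smooth_map (cst Q : G -> 'M[R]_n) by exact: smooth_map_cst.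
have -> : vf_deriv X (form_eval invariant_form Y Z) p =
    map_deriv X (fun q => eval_map Y Z q 0 0 : R) p.
  apply: (congr1 (fun f : G -> R => map_deriv X f p)).
  by apply/funext => q; exact: form_eval_coef.
rewrite -(map_deriv_entry X p 0 0 (smooth_eval_map sY sZ)) /eval_map.
rewrite (map_deriv_mulmx _ _ (smooth_map_mulmx sy sQ) (smooth_map_tr sz)).
rewrite (map_deriv_mulmx _ _ sy sQ) (map_deriv_tr _ _ sz).
by rewrite [map_deriv X (cst Q) p]derive_cst mulmx0 addr0 mxE.
Qed.

Lemma coef_bracket_eq X Y p : smooth_vf X -> smooth_vf Y ->
  coef (vf_bracket X Y) p = map_deriv X (coef Y) p - map_deriv Y (coef X) p
    + br (coef X p) (coef Y p).
Proof. by move=> sX sY; exact: coef_bracket. Qed.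

Lemma invariant_form_unit p : Q \in unitmx -> invariant_form p \in unitmx.
Proof.
move=> uQ; rewrite /invariant_form !unitmx_mul unitmx_tr !unitmx_inv.
by rewrite frame_unit ?uQ.
Qed.

Lemma invariant_form_tr p : (invariant_form p)^T =
  invmx (E p) *m Q^T *m (invmx (E p))^T.
Proof. by rewrite /invariant_form !trmx_mul trmxK mulmxA. Qed.

Lemma invariant_form_frame p : E p *m invariant_form p *m (E p)^T = Q.
Proof.
rewrite /invariant_form !mulmxA mulmxV ?frame_unit // mul1mx -mulmxA -trmx_mul.
by rewrite mulmxV ?frame_unit // trmx1 mulmx1.
Qed.

(** By antisymmetry of [Q] the derivatives of the coefficients cancel in the
    exterior derivative; only the brackets in the Lie algebra are left. *)
Lemma closed_invariant_form : Q^T = - Q ->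
  (forall u v w, (br u v *m Q *m w^T - br u w *m Q *m v^T
                  + br v w *m Q *m u^T) 0 0 = 0) ->
  closed_2form invariant_form.
Proof.
move=> Qanti Qcocycle X Y Z sX sY sZ p.
have bXY := coef_bracket_eq p sX sY.
have bXZ := coef_bracket_eq p sX sZ.
have bYZ := coef_bracket_eq p sY sZ.
move: (vf_bracket X Y) (vf_bracket X Z) (vf_bracket Y Z) bXY bXZ bYZ => U V W bU bV bW.
rewrite (vf_deriv_form_eval X p sY sZ) (vf_deriv_form_eval Y p sX sZ).
rewrite (vf_deriv_form_eval Z p sX sY) !form_eval_coef bU bV bW.
have := Qcocycle (coef X p) (coef Y p) (coef Z p).
move: (map_deriv X (coef Y) p) (map_deriv X (coef Z) p) (map_deriv Y (coef X) p)
  (map_deriv Y (coef Z) p) (map_deriv Z (coef X) p) (map_deriv Z (coef Y) p).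
move: (coef X p) (coef Y p) (coef Z p) => x y z xy xz yx yz zx zy.
have addE (A1 A2 : 'M[R]_1) : (A1 + A2) 0 0 = A1 0 0 + A2 0 0 by rewrite mxE.
have oppE (A : 'M[R]_1) : (- A) 0 0 = - A 0 0 by rewrite mxE.
have Qsym u v : (u *m Q *m v^T) 0 0 = - (v *m Q *m u^T) 0 0.
  have -> : u *m Q *m v^T = (- (v *m Q *m u^T))^T.
    by rewrite linearN /= !trmx_mul trmxK Qanti mulNmx mulmxN opprK mulmxA.
  by rewrite [LHS]mxE oppE.
rewrite !mulmxDl !mulNmx !addE !oppE (Qsym y xz) (Qsym x yz) (Qsym x zy).
by move=> H; rewrite -[RHS]oppr0 -H; ring.
Qed.

End Forms.

Section Connection.
Variable B : {linear 'rV[R]_n -> 'M[R]_n}.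

(** The connection for which the derivative of the frame field [v] along the
    frame field [u] is the frame field [v *m B u]. *)
Definition invariant_connection : connection_op G := fun X Y p =>
  (map_deriv X (coef Y) p + coef Y p *m B (coef X p)) *m E p.

Let nabla := invariant_connection.

Lemma coef_connection X Y : coef (nabla X Y) =
  fun p => map_deriv X (coef Y) p + coef Y p *m B (coef X p).
Proof. by apply/funext => p; exact: (coef_comb FE). Qed.

Let linB : linear B. Proof. by move=> a x y; exact: linearP. Qed.

Let contB : continuous B. Proof. exact: linear_rV_continuous. Qed.

Let smooth_B X : smooth_vf X -> smooth_map (B \o coef X).
Proof. by move=> sX; apply: (smooth_map_linear linB contB); exact: smooth_coef. Qed.

Let smooth_coef_conn X Y : smooth_vf X -> smooth_vf Y ->
  smooth_map (fun p => map_deriv X (coef Y) p + coef Y p *m B (coef X p)).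
Proof.
move=> sX sY; apply: smooth_mapD.
  exact/(smooth_map_deriv sX)/smooth_coef.
by apply: smooth_map_mulmx; [exact: smooth_coef|exact: smooth_B].
Qed.

Lemma smooth_connection X Y : smooth_vf X -> smooth_vf Y -> smooth_vf (nabla X Y).
Proof. by move=> sX sY; apply: (smooth_vf_comb FE); exact: smooth_coef_conn. Qed.

Lemma coef_add X Y p : coef (vf_add X Y) p = coef X p + coef Y p.
Proof. exact: mulmxDl. Qed.

Lemma coef_scale (f : G -> R) X p : coef (vf_scale f X) p = f p *: coef X p.
Proof. by rewrite /coef /frame_coef /vf_scale scalemxAl. Qed.

Lemma affine_invariant_connection : affine_connection nabla.
Proof.
split; first exact: smooth_connection.
- move=> X X' Y _ _ sY; apply/funext => p; have sy := smooth_coef FE sY.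
  rewrite /nabla /invariant_connection /vf_add -mulmxDl; congr (_ *m _).
  rewrite -/(vf_add X X') (map_deriv_addv _ _ _ sy) coef_add linearD mulmxDr.
  exact: addrACA.
- move=> f X Y _ _ sY; apply/funext => p; have sy := smooth_coef FE sY.
  rewrite /nabla /invariant_connection /vf_scale scalemxAl; congr (_ *m _).
  rewrite -/(vf_scale f X) (map_deriv_scalev _ _ _ sy) coef_scale linearZ.
  by rewrite -scalemxAr scalerDr.
- move=> X Y Y' _ sY sY'; apply/funext => p.
  apply: (etrans _ (mulmxDl _ _ _)); congr (_ *m _).
  rewrite (_ : coef (vf_add Y Y') = fun q => coef Y q + coef Y' q); last first.
    by apply/funext => q; exact: coef_add.
  rewrite (map_derivD _ _ (smooth_coef FE sY) (smooth_coef FE sY')) mulmxDl.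
  exact: addrACA.
- move=> f X Y sf _ sY; apply/funext => p.
  have -> : vf_add (vf_scale (vf_deriv X f) Y) (vf_scale f (nabla X Y)) p =
      (map_deriv X f p *: coef Y p +
       f p *: (map_deriv X (coef Y) p + coef Y p *m B (coef X p))) *m E p.
    by rewrite mulmxDl -!scalemxAl (coefK FE).
  congr (_ *m _).
  rewrite (_ : coef (vf_scale f Y) = fun q => f q *: coef Y q); last first.
    by apply/funext => q; exact: coef_scale.
  rewrite (map_deriv_scale _ _ sf (smooth_coef FE sY)).
  by rewrite -addrA scalerDr -scalemxAl.
Qed.

Lemma torsion_free_invariant_connection :
  (forall u v, br u v = v *m B u - u *m B v) -> torsion_free nabla.
Proof.
move=> brB X Y sX sY p.
have := coef_bracket_eq p sX sY; rewrite brB => bE.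
rewrite /torsion /vf_sub -(coefK FE (vf_bracket X Y)) -/coef bE.
rewrite /nabla /invariant_connection -!mulmxBl.
set a := (X in X *m _); suff -> : a = 0 by rewrite mul0mx.
by apply/eqP; rewrite subr_eq0 opprD addrACA.
Qed.

(** [map_deriv_bracket] cancels the second derivatives of the coefficients of
    [Z], and [coef_bracket_eq] cancels those of [X] and [Y]; what is left is
    z (B(y) B(x) - B(x) B(y) - B(br(x, y))). *)
Lemma curvature_free_invariant_connection :
  (forall u v, B (br u v) = B v *m B u - B u *m B v) -> curvature_free nabla.
Proof.
move=> brB X Y Z sX sY sZ p.
have [sx sy sz] := And3 (smooth_coef FE sX) (smooth_coef FE sY) (smooth_coef FE sZ).
have D2 U V : smooth_vf U -> smooth_vf V ->
    nabla U (nabla V Z) p =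
    (map_deriv U (map_deriv V (coef Z)) p
     + (map_deriv U (coef Z) p *m B (coef V p)
        + coef Z p *m B (map_deriv U (coef V) p))
     + (map_deriv V (coef Z) p + coef Z p *m B (coef V p)) *m B (coef U p)) *m E p.
  move=> sU sV; rewrite {1}/nabla /invariant_connection coef_connection.
  congr ((_ + _) *m _).
  have sv := smooth_coef FE sV.
  apply: (etrans (map_derivD U p (smooth_map_deriv sV sz)
    (smooth_map_mulmx sz (smooth_B sV)))).
  congr (_ + _).
  apply: (etrans (map_deriv_mulmx U p sz (smooth_B sV))).
  congr (_ + _ *m _).
  exact: map_deriv_linear.
have bE := coef_bracket_eq p sX sY.
have DE := map_deriv_bracket p sX sY sz.
rewrite /curvature /vf_sub (D2 X Y) // (D2 Y X) //.
rewrite /nabla /invariant_connection DE bE -!mulmxBl.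
set a := (X in X *m _); suff -> : a = 0 by rewrite mul0mx.
rewrite {}/a.
have -> : B (map_deriv X (coef Y) p - map_deriv Y (coef X) p
    + br (coef X p) (coef Y p)) = B (map_deriv X (coef Y) p)
    - B (map_deriv Y (coef X) p) + (B (coef Y p) *m B (coef X p)
    - B (coef X p) *m B (coef Y p)).
  by rewrite linearD linearB brB.
move: (map_deriv X (map_deriv Y (coef Z)) p) (map_deriv Y (map_deriv X (coef Z)) p).
move: (map_deriv X (coef Z) p) (map_deriv Y (coef Z) p) (coef Z p) => xz yz z.
move: (B (map_deriv X (coef Y) p)) (B (map_deriv Y (coef X) p)).
move: (B (coef X p)) (B (coef Y p)) => Bx By Bxy Byx xyz yxz.
rewrite !mulmxDl !mulmxDr !mulmxN !mulmxA.
move: (xz *m By) (yz *m Bx) (z *m Bxy) (z *m Byx) => a1 a2 a3 a4.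
move: (z *m By *m Bx) (z *m Bx *m By) => a5 a6.
by apply/rowP => j; rewrite !mxE; ring.
Qed.

Lemma flat_invariant_connection :
  (forall u v, br u v = v *m B u - u *m B v) ->
  (forall u v, B (br u v) = B v *m B u - B u *m B v) ->
  flat_affine_connection nabla.
Proof.
move=> tors curv; split; first exact: affine_invariant_connection.
  exact: torsion_free_invariant_connection.
exact: curvature_free_invariant_connection.
Qed.

Lemma left_invariant_invariant_connection : left_invariant_connection nabla.
Proof.
move=> a X Y sX sY; apply/funext => p.
rewrite -(mulVKg a p); set q := (a^-1 * p)%g.
have LX : coef (ltrans_vf a X) (a * q)%g = coef X q := coef_ltrans FE a X q.
have LY : coef (ltrans_vf a Y) (a * q)%g = coef Y q := coef_ltrans FE a Y q.
rewrite -[LHS](coefK FE) (coef_ltrans FE) -/coef coef_connection.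
have DE : map_deriv (ltrans_vf a X) (coef (ltrans_vf a Y)) (a * q)%g =
    map_deriv X (coef Y) q.
  rewrite [coef (ltrans_vf a Y)](coef_ltransE FE).
  exact: map_deriv_ltrans (smooth_coef FE sY).
exact: (esym (congr1 (fun k => k *m E (a * q)%g) (congr2 (fun k l => k + l) DE
  (congr2 (fun k l => k *m B l) LY LX)))).
Qed.

(** The derivatives of the coefficients match by the Leibniz rule, and the terms
    in [B] cancel because [B u] is skew for [Q]. *)
Lemma levi_civita_invariant (Q : 'M[R]_n) :
  (forall u v, br u v = v *m B u - u *m B v) ->
  (forall u, B u *m Q + Q *m (B u)^T = 0) ->
  levi_civita (invariant_form Q) nabla.
Proof.
move=> tors skew; split.
- exact: affine_invariant_connection.
- exact: torsion_free_invariant_connection.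
move=> X Y Z sX sY sZ p; rewrite (vf_deriv_form_eval Q X p sY sZ) !form_eval_coef.
rewrite !coef_connection.
move: (map_deriv X (coef Y) p) (map_deriv X (coef Z) p) => y' z'.
have := skew (coef X p); move: (B (coef X p)) (coef Y p) (coef Z p) => b y z bQ.
have addE (A1 A2 : 'M[R]_1) : (A1 + A2) 0 0 = A1 0 0 + A2 0 0 by rewrite mxE.
rewrite !mulmxDl linearD /= mulmxDr !addE trmx_mul.
rewrite -!addrA; congr (_ + _).
rewrite addrCA -[LHS]addr0; congr (_ + _).
have bQE : y *m b *m Q *m z^T + y *m Q *m (b^T *m z^T) = 0.
  rewrite (_ : _ + _ = y *m (b *m Q + Q *m b^T) *m z^T).
    by rewrite bQ mulmx0 mul0mx.
  by rewrite mulmxDr mulmxDl !mulmxA.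
by rewrite -addE bQE mxE.
Qed.

End Connection.

(** If the rows of [P] are an orthonormal basis for [Q], those of [P *m E p] are
    one at [p]. *)
Lemma lorentz_invariant_form (Q P : 'M[R]_n) : Q^T = Q -> P \in unitmx ->
  P *m Q *m P^T = diag_mx (\row_(i < n) (if (i : nat) == 0%N then - 1 else 1)) ->
  lorentz_metric (invariant_form Q).
Proof.
move=> Qsym uP PQ; split; first exact: smooth_invariant_form.
move=> p; split; first by rewrite invariant_form_tr Qsym.
exists (P *m E p); split; first by rewrite unitmx_mul uP frame_unit.
rewrite trmx_mul -PQ -[in RHS](invariant_form_frame Q p).
by rewrite !mulmxA.
Qed.

Lemma symplectic_invariant_form (Q : 'M[R]_n) : Q^T = - Q -> Q \in unitmx ->
  (forall u v w, (br u v *m Q *m w^T - br u w *m Q *m v^T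
                  + br v w *m Q *m u^T) 0 0 = 0) ->
  symplectic_form (invariant_form Q).
Proof.
move=> Qanti uQ Qcocycle; split.
- exact: smooth_invariant_form.
- by move=> p; rewrite invariant_form_tr Qanti mulmxN mulNmx.
- by move=> p; exact: invariant_form_unit.
- exact: closed_invariant_form.
Qed.

End InvariantStructures.

(** * The dual of the oscillator algebra *)

Section Oscillator.
Context {R : realType}.
Implicit Types (r : 'M[R]_4) (a b : 'cV[R]_4) (x y u v w : 'rV[R]_4).

Let o0 : 'I_4 := Ordinal (isT : (0 < 4)%N).
Let o1 : 'I_4 := Ordinal (isT : (1 < 4)%N).
Let o2 : 'I_4 := Ordinal (isT : (2 < 4)%N).
Let o3 : 'I_4 := Ordinal (isT : (3 < 4)%N).

Lemma ord4P (P : 'I_4 -> Prop) : P o0 -> P o1 -> P o2 -> P o3 -> forall i, P i.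
Proof.
by move=> P0 P1 P2 P3 [[|[|[|[|//]]]] i4];
  [move: P0|move: P1|move: P2|move: P3]; congr P; exact: val_inj.
Qed.

Lemma sum4 (F : 'I_4 -> R) : \sum_i F i = F o0 + F o1 + F o2 + F o3.
Proof.
rewrite !big_ord_recr big_ord0 /= add0r.
by congr (_ + _ + _ + _); congr F; exact: val_inj.
Qed.

Lemma inord4E : ((@inord 3 0 = o0) * (@inord 3 1 = o1) * (@inord 3 2 = o2) *
  (@inord 3 3 = o3))%type.
Proof. by do !split; apply: val_inj; rewrite /= inordK. Qed.

Lemma osc_bracketE x y : ((osc_bracket x y 0 o0 = x 0 o1 * y 0 o2 - x 0 o2 * y 0 o1) *
  (osc_bracket x y 0 o1 = - (x 0 o3 * y 0 o2 - x 0 o2 * y 0 o3)) *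
  (osc_bracket x y 0 o2 = x 0 o3 * y 0 o1 - x 0 o1 * y 0 o3) *
  (osc_bracket x y 0 o3 = 0))%type.
Proof.
by do !split; rewrite /osc_bracket !inord4E !mxE /=; ring.
Qed.

(** The equation for r, evaluated on the elements [i], [j], [k] of the dual basis. *)
Lemma cybe_entries r i j k : cybe_solution (@osc_bracket R) r ->
  osc_bracket (row j r) (row k r) 0 i + osc_bracket (row k r) (row i r) 0 j +
  osc_bracket (row i r) (row j r) 0 k = 0.
Proof.
move=> [_ /(_ (delta_mx i 0) (delta_mx j 0) (delta_mx k 0))].
by rewrite /pairing /r_sharp !trmx_delta -!rowE -!colE !mxE.
Qed.

(** The component (1, 2, 3) of the equation reads r_23^2 + r_13^2 = 0; then the
    component (0, 1, 2) reads r_12^2 = 0. *)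
Lemma cybe_oscillator r : cybe_solution (@osc_bracket R) r ->
  forall i j, i != o0 -> j != o0 -> r i j = 0.
Proof.
move=> Hr; have [ra _] := Hr.
have anti i j : r i j = - r j i by rewrite -[in LHS](trmxK r) mxE ra mxE.
have diag i : r i i = 0 by have := anti i i; lra.
have := cybe_entries o1 o2 o3 Hr; have := cybe_entries o0 o1 o2 Hr.
rewrite !osc_bracketE !mxE.
rewrite ?diag ?(anti o2 o1) ?(anti o3 o1) ?(anti o3 o2) ?(anti o1 o0) ?(anti o2 o0).
move=> H1 H2.
have r23 : r o2 o3 = 0 by nra.
have r13 : r o1 o3 = 0 by nra.
have r12 : r o1 o2 = 0 by move: H1; rewrite r23 r13; nra.
by apply: ord4P; [by []| | |]; apply: ord4P => // _ _;
  rewrite ?diag // ?r12 ?r13 ?r23 // anti ?r12 ?r13 ?r23 oppr0.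
Qed.

Definition mx4 (s : seq (seq R)) : 'M[R]_4 := \matrix_(i, j) nth 0 (nth [::] s i) j.

(** The opposite of the coadjoint action of the vector (0, a1, a2, a3), acting on
    rows of coordinates in the dual basis. *)
Definition coad_mx r : 'M[R]_4 :=
  let a1 := r o0 o1 in let a2 := r o0 o2 in let a3 := r o0 o3 in
  mx4 [:: [:: 0; a2; - a1; 0]; [:: 0; 0; a3; - a2]; [:: 0; - a3; 0; a1];
          [:: 0; 0; 0; 0]].

Lemma dual_bracketE r u v : cybe_solution (@osc_bracket R) r ->
  (dual_bracket (@osc_bracket R) r u^T v^T)^T =
  u 0 o0 *: (v *m coad_mx r) - v 0 o0 *: (u *m coad_mx r).
Proof.
move=> Hr; have r0 := cybe_oscillator Hr.
have rE y k : k != o0 -> (r_sharp r y^T) 0 k = y 0 o0 * r o0 k.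
  move=> k0; rewrite /r_sharp trmxK mxE sum4 (r0 o1) // (r0 o2) // (r0 o3) //; ring.
apply/rowP; apply: ord4P; rewrite !mxE /pairing !mxE !sum4 !osc_bracketE !rE // !mxE /=;
 ring.
Qed.

(** The dual of the invariant form of the oscillator algebra, in which e0 and d
    are isotropic with product 1. *)
Definition lorentz4 : 'M[R]_4 :=
  mx4 [:: [:: 0; 0; 0; 1]; [:: 0; 1; 0; 0]; [:: 0; 0; 1; 0]; [:: 1; 0; 0; 0]].

(** The Gram matrix of u_0 v_3 - u_3 v_0 + u_1 v_2 - u_2 v_1. *)
Definition symplectic4 : 'M[R]_4 :=
  mx4 [:: [:: 0; 0; 0; 1]; [:: 0; 0; 1; 0]; [:: 0; - 1; 0; 0]; [:: - 1; 0; 0; 0]].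

(** The isotropic plane spanned by e0* and d* contains e0* - d*/2 and
    e0* + d*/2, of square -1 and 1. *)
Definition lorentz_basis4 : 'M[R]_4 :=
  mx4 [:: [:: 1; 0; 0; - 2^-1]; [:: 0; 1; 0; 0]; [:: 0; 0; 1; 0]; [:: 1; 0; 0; 2^-1]].

Lemma lorentz4_sym : lorentz4^T = lorentz4.
Proof. by apply/matrixP; apply: ord4P; apply: ord4P; rewrite !mxE. Qed.

Lemma lorentz4_diag : lorentz_basis4 *m lorentz4 *m lorentz_basis4^T =
  diag_mx (\row_(i < 4) (if (i : nat) == 0%N then - 1 else 1)).
Proof.
apply/matrixP; apply: ord4P; apply: ord4P; rewrite !mxE sum4 !mxE !sum4 !mxE /=;
  by field.
Qed.

Lemma lorentz_basis4_unit : lorentz_basis4 \in unitmx.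
Proof.
have DD : diag_mx (\row_(i < 4) (if (i : nat) == 0%N then - 1 else 1 : R)) *m
    diag_mx (\row_(i < 4) (if (i : nat) == 0%N then - 1 else 1)) = 1%:M.
  by apply/matrixP; apply: ord4P; apply: ord4P; rewrite !mxE sum4 !mxE /=; ring.
rewrite -lorentz4_diag -!mulmxA in DD.
by have [] := mulmx1_unit DD.
Qed.

(** This is the invariance of the scalar product of the oscillator algebra. *)
Lemma coad_mx_skew r : coad_mx r *m lorentz4 + lorentz4 *m (coad_mx r)^T = 0.
Proof.
by apply/matrixP; apply: ord4P; apply: ord4P; rewrite !mxE !sum4 !mxE /=; ring.
Qed.

Lemma symplectic4_anti : symplectic4^T = - symplectic4.
Proof.
by apply/matrixP; apply: ord4P; apply: ord4P; rewrite !mxE /= ?oppr0 ?opprK.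
Qed.

Lemma symplectic4_unit : symplectic4 \in unitmx.
Proof.
have : symplectic4 *m symplectic4^T = 1%:M.
  by apply/matrixP; apply: ord4P; apply: ord4P; rewrite !mxE sum4 !mxE /=; ring.
by case/mulmx1_unit.
Qed.

Lemma coad_mx0 r u : (u *m coad_mx r) 0 o0 = 0.
Proof. by rewrite mxE sum4 !mxE /= !mulr0 !addr0. Qed.

(** The opposite of the coadjoint action of the vector that [r] attaches to [u]:
    as e0 is central, this vector acts like [u 0 o0] times the first row of [r]. *)
Definition osc_conn r u : 'M[R]_4 := u 0 o0 *: coad_mx r.

Lemma osc_conn_is_linear r : linear (osc_conn r).
Proof. by move=> k u v; rewrite /osc_conn !mxE scalerDl scalerA. Qed.

HB.instance Definition _ r :=
  GRing.isLinear.Build R 'rV[R]_4 'M[R]_4 _ (osc_conn r) (osc_conn_is_linear r).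

Definition osc_dual r u v : 'rV[R]_4 := (dual_bracket (@osc_bracket R) r u^T v^T)^T.

Section OscDual.
Variable r : 'M[R]_4.
Hypothesis Hr : cybe_solution (@osc_bracket R) r.

Lemma osc_conn_torsion u v :
  osc_dual r u v = v *m osc_conn r u - u *m osc_conn r v.
Proof. by rewrite /osc_dual dual_bracketE // -!scalemxAr. Qed.

(** Both sides vanish: [coad_mx r] has no component on e0*, so brackets have none
    either, and the operators [osc_conn r u] are proportional to one matrix. *)
Lemma osc_conn_curvature u v : osc_conn r (osc_dual r u v) =
  osc_conn r v *m osc_conn r u - osc_conn r u *m osc_conn r v.
Proof.
have -> : osc_conn r (osc_dual r u v) = 0.
  rewrite /osc_conn /osc_dual dual_bracketE //.
  have := coad_mx0 r u; have := coad_mx0 r v.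
  move: (u *m _) (v *m _) => x y y0 x0.
  by rewrite !mxE y0 x0 !mulr0 subrr scale0r.
by rewrite /osc_conn -!scalemxAl -!scalemxAr !scalerA [u 0 o0 * _]mulrC subrr.
Qed.

Lemma osc_conn_skew u :
  osc_conn r u *m lorentz4 + lorentz4 *m (osc_conn r u)^T = 0.
Proof.
rewrite /osc_conn [(_ *: coad_mx r)^T]linearZ /= -scalemxAl -scalemxAr -scalerDr.
by rewrite coad_mx_skew scaler0.
Qed.

(** Expanded, the identity is the vanishing of the trace of [coad_mx r] on the
    span of e1* and e2* modulo d*. *)
Lemma symplectic4_cocycle u v w :
  (osc_dual r u v *m symplectic4 *m w^T - osc_dual r u w *m symplectic4 *m v^T
    + osc_dual r v w *m symplectic4 *m u^T) 0 0 = 0.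
Proof.
have sE x y : (x *m symplectic4 *m y^T) 0 0 =
    x 0 o0 * y 0 o3 - x 0 o3 * y 0 o0 + x 0 o1 * y 0 o2 - x 0 o2 * y 0 o1.
  by rewrite mxE sum4 !mxE !sum4 !mxE /=; ring.
have cE x : ((x *m coad_mx r) 0 o1 = x 0 o0 * r o0 o2 - x 0 o2 * r o0 o3) *
    ((x *m coad_mx r) 0 o2 = - (x 0 o0 * r o0 o1) + x 0 o1 * r o0 o3) *
    ((x *m coad_mx r) 0 o3 = - (x 0 o1 * r o0 o2) + x 0 o2 * r o0 o1).
  by do !split; rewrite mxE sum4 !mxE /=; ring.
have addE (A1 A2 : 'M[R]_1) : (A1 + A2) 0 0 = A1 0 0 + A2 0 0 by rewrite mxE.
have oppE (A : 'M[R]_1) : (- A) 0 0 = - A 0 0 by rewrite mxE.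
have brE x y k : osc_dual r x y 0 k =
    x 0 o0 * (y *m coad_mx r) 0 k - y 0 o0 * (x *m coad_mx r) 0 k.
  rewrite /osc_dual dual_bracketE //.
  by move: (x *m _) (y *m _) => A1 A2; rewrite !mxE.
by rewrite !addE !oppE !sE !brE !coad_mx0 !cE; ring.
Qed.

End OscDual.

End Oscillator.

Theorem theorem2p3 (R : realType) (r : 'M[R]_4) (G : lieGroupType R 4) :
  cybe_solution (@osc_bracket R) r ->
  has_lie_algebra G (dual_bracket (@osc_bracket R) r) ->
  [/\ exists g : form_field G,
        [/\ lorentz_metric g, left_invariant_form g & flat_metric g],
      exists w : form_field G,
        symplectic_form w /\ left_invariant_form w &
      exists nabla : connection_op G,
        flat_affine_connection nabla /\ left_invariant_connection nabla].
Proof.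
move=> Hr /has_lie_algebra_frame[E FE Ebr].
pose Q := invariant_form E; pose nabla := invariant_connection E (osc_conn r).
have tors := osc_conn_torsion Hr; have curv := osc_conn_curvature Hr.
have flat : flat_affine_connection nabla.
  exact: (flat_invariant_connection FE Ebr tors curv).
split.
- exists (Q lorentz4); split.
  + exact: (lorentz_invariant_form FE lorentz4_sym lorentz_basis4_unit
      lorentz4_diag).
  + exact: left_invariant_invariant_form.
  + exists nabla; last by case: flat.
    exact: (levi_civita_invariant FE Ebr tors (osc_conn_skew r)).
- exists (Q symplectic4); split; last exact: left_invariant_invariant_form.
  exact: (symplectic_invariant_form FE Ebr symplectic4_anti
    symplectic4_unit (symplectic4_cocycle Hr)).
- exists nabla; split => //.
  exact: (left_invariant_invariant_connection FE (osc_conn r)).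
Qed.
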